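(* Let $\kappa$ be a number field of class number $1$ with ring of integers $\mathcal{O}_\kappa$. Consider a family of complementary configurations of type $(k,n)$ over $R=\kappa[[t]]$, i.e. closures $\underline A_i,\underline B_j\subset\mathbb{P}^n_R$ ($i,j\in\{1,2\}$) of a complementary configuration over $\kappa((t))$, which is algebraic: it is obtained from a family defined over a quasi-projective curve over $\kappa$, with $t$ a local coordinate at the point $t=0$. Let $A_i^s,B_j^s\subset\mathbb{P}^n_\kappa$ be the fibres over $t=0$. For each embedding $\sigma:\kappa\hookrightarrow\mathbb{C}$ let $u_\sigma(0)\in\mathbb{C}^\times$ be the limit period of the complexified family. Then for every $\sigma$ $$\log|u_\sigma(0)|=\log\big|(A_1^s,A_2^s;B_1^s,B_2^s)_\kappa\big|_\sigma+\log\big|\mathfrak{c}_{\mathrm{lim}}^\otimes/\mathfrak{c}_{\mathrm{ar}}^\otimes\big|_\sigma\ \in\ \mathbb{R}/\log|\mathcal{O}_\kappa^\times|_\sigma,$$ and summing over all embeddings $$\sum_{\sigma:\kappa\hookrightarrow\mathbb{C}}\log|u_\sigma(0)|=\log N(A_1^s,A_2^s;B_1^s,B_2^s)_\kappa+\log N(\mathfrak{c}_{\mathrm{lim}}^\otimes/\mathfrak{c}_{\mathrm{ar}}^\otimes)\ \in\ \mathbb{R}.$$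
   Context: Notation: $\det W=\bigwedge^{\mathrm{rank}\,W}W$ (so $\det 0$ is the base ring), and $\hat A$ denotes the linear subspace of the ambient vector space whose projectivisation is $A$. $|x|_\sigma=|\sigma(x)|$. $N$ is the absolute value of the norm $\kappa^\times\to\mathbb{Q}^\times$, which is well defined on $\kappa^\times/\mathcal{O}_\kappa^\times$. **Cross-ratio.** A complementary configuration of type $(k,n)$ over a field $K$ is a quadruple of linear subspaces $A_1,A_2,B_1,B_2\subset\mathbb{P}(V)$, $\dim V=n+1$, with $\dim A_i=k$, $\dim B_j=n-k-1$, $A_i\cap B_j=\emptyset$ for all $i,j$. With generators $a_i\in\det\hat A_i$, $b_j\in\det\hat B_j$, its cross-ratio is $(A_1,A_2;B_1,B_2)=\frac{a_1\wedge b_1}{a_1\wedge b_2}\frac{a_2\wedge b_2}{a_2\wedge b_1}\in K^\times$. **Degenerate cross-ratio.** A degenerate complementary configuration is the same without any assumption on $A_i\cap B_j$. Put $\hat S_{ij}=\hat A_i\cap\hat B_j$, $\hat Q_{ij}=V/(\hat A_i+\hat B_j)$. There is a canonical isomorphism $$\det\hat A_i\otimes\det\hat B_j\otimes\mathrm{Hom}(\det\hat S_{ij},\det\hat Q_{ij})\xrightarrow{\ \sim\ }\det V\qquad( * )$$ $a\otimes b\otimes\phi\mapsto a\wedge b'\wedge\phi(s)$, where $s$ generates $\det\hat S_{ij}$, $\hat B_j=B'\oplus\hat S_{ij}$, $b'\in\det B'$, $b=b'\wedge s$. For $\mathfrak{c}=(\mathfrak{c}_{11},\mathfrak{c}_{12},\mathfrak{c}_{21},\mathfrak{c}_{22})$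 with $0\neq\mathfrak{c}_{ij}\in\mathrm{Hom}(\det\hat S_{ij},\det\hat Q_{ij})$ define, computing ratios in $\det V$ via $( * )$, $$(A_1,A_2;B_1,B_2)_{\mathfrak{c}}=\frac{a_1\otimes b_1\otimes\mathfrak{c}_{11}}{a_1\otimes b_2\otimes\mathfrak{c}_{12}}\,\frac{a_2\otimes b_2\otimes\mathfrak{c}_{22}}{a_2\otimes b_1\otimes\mathfrak{c}_{21}}.$$ It depends on $\mathfrak{c}$ only through $\mathfrak{c}^\otimes=\mathfrak{c}_{11}\otimes\mathfrak{c}_{22}\otimes\mathfrak{c}_{12}^{-1}\otimes\mathfrak{c}_{21}^{-1}$, an element of a one-dimensional space. **Limit perturbation.** Let $\mathfrak{m}=(t)\subset R=\kappa[[t]]$, $\mathcal{V}=R^{n+1}$, and let $A_i,B_j$ be the generic fibres over $K=\kappa((t))$. For each $(i,j)$ let $\hat{\mathcal{A}}_i=\hat A_i\cap\mathcal{V}$, $\hat{\mathcal{B}}_j=\hat B_j\cap\mathcal{V}$, $\Psi_{ij}:\hat{\mathcal{A}}_i\oplus\hat{\mathcal{B}}_j\to\mathcal{V}$ the sum of inclusions, and $v_R(\det\Psi_{ij})$ the $t$-adic valuation of its determinant in $R$-bases. The isomorphism $\mathrm{reg}_t\det\Psi_{ij}=\big(t^{-v_R(\det\Psi_{ij})}\det\Psi_{ij}\bmod\mathfrak{m}\big):\det\hat A_i^s\otimes\det\hat B_j^s\to\det\kappa^{n+1}$ corresponds under $( * )$ (for $A_i^s,B_j^s$ over $\kappa$)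 to a unique $\mathfrak{c}_{\mathrm{lim},ij}\in\mathrm{Hom}(\det\hat S_{ij},\det\hat Q_{ij})$, meaning $a\otimes b\otimes\mathfrak{c}_{\mathrm{lim},ij}\mapsto(\mathrm{reg}_t\det\Psi_{ij})(a\otimes b)$. Here $\hat S_{ij}=\hat A_i^s\cap\hat B_j^s$ and $\hat Q_{ij}=\kappa^{n+1}/(\hat A_i^s+\hat B_j^s)$. **Arithmetic perturbation and arithmetic cross-ratio.** Let $\mathcal{L}=\mathcal{O}_\kappa^{n+1}$. Let $\mathcal{S}_{ij}=\hat S_{ij}\cap\mathcal{L}$, and let $\mathcal{Q}_{ij}$ be the quotient of $\mathcal{L}$ by the saturation of $(\hat A_i^s\cap\mathcal{L})+(\hat B_j^s\cap\mathcal{L})$ in $\mathcal{L}$. Since $\mathcal{O}_\kappa$ is a PID, $\mathrm{Hom}_{\mathcal{O}_\kappa}(\det\mathcal{S}_{ij},\det\mathcal{Q}_{ij})$ is free of rank one; $\mathfrak{c}_{\mathrm{ar},ij}$ is a generator, well defined up to $\mathcal{O}_\kappa^\times$. The arithmetic cross-ratio is $(A_1^s,A_2^s;B_1^s,B_2^s)_\kappa:=(A_1^s,A_2^s;B_1^s,B_2^s)_{\mathfrak{c}_{\mathrm{ar}}}\in\kappa^\times/\mathcal{O}_\kappa^\times$. The ratio $\mathfrak{c}_{\mathrm{lim}}^\otimes/\mathfrak{c}_{\mathrm{ar}}^\otimes$ is an element of $\kappa^\times/\mathcal{O}_\kappa^\times$. **Limit periods.** By algebraicity, for each $\sigma$ the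 equations of the planes converge near $t=0$ after applying $\sigma$, giving a holomorphic family of complementary configurations over a punctured disk. Its cross-ratio is $t^{m}u_\sigma(t)$ with $m\in\mathbb{Z}$ and $u_\sigma$ holomorphic and non-zero at $0$; equivalently the Archimedean height pairing of $\underline A_1(t)-\underline A_2(t)$ and $\underline B_1(t)-\underline B_2(t)$ is $m\log|t|+\log|u_\sigma(t)|$ for $|t|\ll1$. The value $u_\sigma(0)$ is the limit period. *)

(* Defs.v *)
From HB Require Import structures.
From mathcomp Require Import all_boot all_order all_algebra all_field.
From mathcomp Require Import complex.
From mathcomp Require Import all_classical all_reals all_analysis.

Set Implicit Arguments.
Unset Strict Implicit.
Unset Printing Implicit Defensive.

Import Order.TTheory GRing.Theory Num.Theory.
Import numFieldNormedType.Exports.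

Local Open Scope ring_scope.
Local Open Scope classical_set_scope.

(* The ring F[[t]]; its fraction field is F((t)). *)
Record fps (F : fieldType) := Fps { fps_coef : nat -> F }.

Section FpsRing.
Variable F : fieldType.
Implicit Types f g h : fps F.

HB.instance Definition _ := gen_eqMixin (fps F).
HB.instance Definition _ := gen_choiceMixin (fps F).

Lemma fpsP f g : (forall n, fps_coef f n = fps_coef g n) -> f = g.
Proof. by case: f g => [f] [g] /= /funext ->. Qed.

Definition fps_add f g := Fps (fun n => fps_coef f n + fps_coef g n).
Definition fps_opp f := Fps (fun n => - fps_coef f n).
Definition fps_const (c : F) := Fps (fun n => if n == 0%N then c else 0).
Definition fps_mul f g :=
  Fps (fun n => \sum_(i < n.+1) fps_coef f i * fps_coef g (n - i)).

Fact fps_addA : associative fps_add.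
Proof. by move=> f g h; apply: fpsP => n; exact: addrA. Qed.
Fact fps_addC : commutative fps_add.
Proof. by move=> f g; apply: fpsP => n; exact: addrC. Qed.
Fact fps_add0 : left_id (fps_const 0) fps_add.
Proof. by move=> f; apply: fpsP => n /=; rewrite if_same add0r. Qed.
Fact fps_addN : left_inverse (fps_const 0) fps_opp fps_add.
Proof. by move=> f; apply: fpsP => n /=; rewrite if_same addNr. Qed.

HB.instance Definition _ :=
  GRing.isZmodule.Build (fps F) fps_addA fps_addC fps_add0 fps_addN.

Let trunc N f : {poly F} := \poly_(i < N.+1) fps_coef f i.

Let coef_trunc N f i : (i <= N)%N -> (trunc N f)`_i = fps_coef f i.
Proof. by move=> iN; rewrite coef_poly ltnS iN. Qed.

Let coef_mul N f g i : (i <= N)%N ->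
  fps_coef (fps_mul f g) i = (trunc N f * trunc N g)`_i.
Proof.
move=> iN; rewrite coefM; apply: eq_bigr => -[j /=]; rewrite ltnS => ji _.
by rewrite !coef_trunc ?(leq_trans _ iN) ?leq_subr.
Qed.

Fact fps_mulA : associative fps_mul.
Proof.
move=> f g h; apply: fpsP => n.
transitivity ((trunc n f * (trunc n g * trunc n h))`_n).
  rewrite coefM; apply: eq_bigr => -[j /=]; rewrite ltnS => jn _.
  by rewrite coef_trunc // -coef_mul // leq_subr.
rewrite mulrA coefM; apply: eq_bigr => -[j /=]; rewrite ltnS => jn _.
by rewrite coef_trunc ?leq_subr // -coef_mul.
Qed.

Fact fps_mulC : commutative fps_mul.
Proof.
by move=> f g; apply: fpsP => n; rewrite !(@coef_mul n) // mulrC.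
Qed.

Fact fps_mul1 : left_id (fps_const 1) fps_mul.
Proof.
move=> f; apply: fpsP => n /=.
by rewrite big_ord_recl subn0 mul1r big1 ?addr0 // => i _; rewrite mul0r.
Qed.

Fact fps_mulDl : left_distributive fps_mul fps_add.
Proof.
move=> f g h; apply: fpsP => n /=.
by rewrite -big_split; apply: eq_bigr => i _; rewrite mulrDl.
Qed.

Fact fps_oner_neq0 : fps_const 1 != 0 :> fps F.
Proof.
apply/eqP => /(congr1 (fun f => fps_coef f 0)) /= /eqP.
by rewrite oner_eq0.
Qed.

HB.instance Definition _ := GRing.Zmodule_isComNzRing.Build (fps F)
  fps_mulA fps_mulC fps_mul1 fps_mulDl fps_oner_neq0.

Let fps_unit : pred (fps F) := fun f => `[< exists g, g * f = 1 >].

Let fps_inv f :=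
  if pselect (exists g, g * f = 1) is left fU then projT1 (cid fU) else f.

Fact fps_mulVf : {in fps_unit, left_inverse 1 fps_inv *%R}.
Proof.
move=> f /asboolP fU; rewrite /fps_inv; case: pselect => // fU'.
by case: cid.
Qed.

Fact fps_unitP f g : g * f = 1 -> fps_unit f.
Proof. by move=> gf; apply/asboolP; exists g. Qed.

Fact fps_inv_out : {in [predC fps_unit], fps_inv =1 id}.
Proof. by move=> f /asboolP fU; rewrite /fps_inv; case: pselect. Qed.

HB.instance Definition _ := GRing.ComNzRing_hasMulInverse.Build (fps F)
  fps_mulVf fps_unitP fps_inv_out.

Fact fps_mul_eq0 f g : f * g = 0 -> (f == 0) || (g == 0).
Proof.
have low h : h != 0 -> exists2 m, fps_coef h m != 0 &
    forall i, (i < m)%N -> fps_coef h i = 0.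
  move=> h0; have exm : exists m, fps_coef h m != 0.
    apply: contrapT => /forallNP hn; move/eqP: h0; apply; apply: fpsP => n.
    by move/negP/negPn/eqP: (hn n) => ->; rewrite /= if_same.
  exists (ex_minn exm); first by case: ex_minnP.
  case: ex_minnP => m _ mmin i im; apply/eqP; apply: contraTT im => hi.
  by rewrite -leqNgt mmin.
move=> fg; apply: contrapT => /negP; rewrite negb_or => /andP[f0 g0].
have [m fm mmin] := low f f0; have [p gp pmin] := low g g0.
have := congr1 (fun h => fps_coef h (m + p)) fg.
rewrite /= (bigD1 (inord m)) //= inordK ?ltnS ?leq_addr // addKn big1.
  by rewrite addr0 if_same => /eqP; rewrite mulf_eq0 (negPf fm) (negPf gp).
move=> i; rewrite -val_eqE /= inordK ?ltnS ?leq_addr // => im.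
case: (ltngtP i m) im => // im _; first by rewrite mmin // mul0r.
rewrite [X in _ * X]pmin ?mulr0 // ltn_subLR ?ltn_add2r //.
by rewrite -ltnS ltn_ord.
Qed.

HB.instance Definition _ := GRing.ComUnitRing_isIntegral.Build (fps F) fps_mul_eq0.

End FpsRing.

Notation laurent F := {fraction (fps F)}.

Definition fps_t (F : fieldType) : fps F := Fps (fun m => (m == 1%N)%:R).

Definition laurent_const (F : fieldType) (c : F) : laurent F :=
  tofrac (fps_const c).

Definition laurent_t (F : fieldType) : laurent F := tofrac (fps_t F).

(* The t-adic valuation (a junk value at f = 0). *)
Definition fps_val (F : fieldType) (f : fps F) : nat :=
  xget 0%N [set m | fps_coef f m != 0 /\
                    forall i, (i < m)%N -> fps_coef f i = 0].

(* t^(- v(f)) f mod t, for f != 0. *)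
Definition fps_reg (F : fieldType) (f : fps F) : F := fps_coef f (fps_val f).

Section Determinants.

(* The coordinate of X_0 /\ ... /\ X_n on the standard generator of
   det S^(n+1); X is meant to have size n + 1. *)
Definition wedge (S : comNzRingType) (n : nat) (X : seq 'rV[S]_n.+1) : S :=
  \det (\matrix_(i < n.+1, j < n.+1) X`_i 0 j).

Variables (F : fieldType) (n : nat).
Local Notation V := 'rV[F]_n.+1.
Implicit Types (A B S W : {vspace V}) (X Y a b s q : seq V).

(* For bases X, Y of the same space, the scalar with /\X = vol X Y . /\Y. *)
Definition vol X Y : F :=
  \det (\matrix_(i < size Y, j < size Y) coord (in_tuple Y) j X`_i).

(* q lifts a basis of V / W. *)
Definition quotient_basis W q : bool := basis_of fullv (vbasis W ++ q).

(* A homomorphism phi : det S -> det (V / W) is encoded by its coefficients on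
   all pairs of bases: phi (/\s) = phi s q . /\q mod W.  Functions of a pair of
   bases come from such a phi exactly when they satisfy the change-of-bases
   rule below; note that vol (w ++ q') (w ++ q), with w a basis of W, is the
   determinant of the change of bases from q to q' in V / W. *)
Definition homdet := seq V -> seq V -> F.

Definition is_homdet S W (phi : homdet) : Prop :=
  forall s s' q q', basis_of S s -> basis_of S s' ->
    quotient_basis W q -> quotient_basis W q' ->
    phi s' q' * vol (vbasis W ++ q') (vbasis W ++ q) = vol s' s * phi s q.

(* The image of (/\a) (x) (/\b) (x) phi under the canonical isomorphism
   det A (x) det B (x) Hom (det S, det Q) -> det V, S = A :&: B, Q = V/(A + B),
   i.e. a /\ b' /\ phi(s) with B = B' (+) S and /\b = b' /\ s.  It depends
   neither on the basis s of S nor on b' nor on q, so they are fixed here. *)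
Definition star A B a b (phi : homdet) : F :=
  let s := vbasis (A :&: B) in
  let b' := vbasis (B :\: A) in
  let q := vbasis (A + B)^C in
  vol b (b' ++ s) * phi s q * wedge (a ++ b' ++ q).

(* Type (k, n): projective dimensions k and n - k - 1.  The truncated
   subtraction is harmless since \dim (A i) = k + 1 forces k <= n. *)
Definition complementary (k : nat) (A B : 'I_2 -> {vspace V}) : Prop :=
  [/\ forall i, \dim (A i) = k.+1,
      forall j, \dim (B j) = (n - k)%N &
      forall i j, (A i :&: B j = 0)%VS].

Definition cross_ratio (A B : 'I_2 -> {vspace V}) : F :=
  let w i j := wedge (vbasis (A i) ++ vbasis (B j)) in
  (w 0 0 / w 0 1) * (w 1 1 / w 1 0).

Definition degenerate_cross_ratio (A B : 'I_2 -> {vspace V})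
    (c : 'I_2 -> 'I_2 -> homdet) : F :=
  let w i j := star (A i) (B j) (vbasis (A i)) (vbasis (B j)) (c i j) in
  (w 0 0 / w 0 1) * (w 1 1 / w 1 0).

(* The ratio of c_11 (x) c_22 (x) c_12^-1 (x) c_21^-1 and the same tensor built
   from d. *)
Definition tensor_ratio (A B : 'I_2 -> {vspace V})
    (c d : 'I_2 -> 'I_2 -> homdet) : F :=
  let r i j := let s := vbasis (A i :&: B j) in
               let q := vbasis (A i + B j)^C in c i j s q / d i j s q in
  (r 0 0 * r 1 1) / (r 0 1 * r 1 0).

End Determinants.

(* X lifts a basis of the module M / N over the scalars O (so X is a basis of M
   when N = 0). *)
Definition module_basis (S : comNzRingType) (V : lmodType S)
    (O : set S) (M N : set V) (X : seq V) : Prop :=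
  (forall x, x \in X -> M x) /\
  forall v, M v -> exists! c : 'I_(size X) -> S,
    (forall i, O (c i)) /\ N (v - \sum_i c i *: X`_i).

Section Family.
Variables (kappa : fieldType) (n : nat).
Local Notation K := (laurent kappa).
Local Notation VK := 'rV[K]_n.+1.
Local Notation Vk := 'rV[kappa]_n.+1.
Implicit Types A B : {vspace VK}.

Definition toK (w : 'rV[fps kappa]_n.+1) : VK := map_mx (@tofrac _) w.
Definition red (w : 'rV[fps kappa]_n.+1) : Vk :=
  map_mx (fun f => fps_coef f 0) w.

(* The intersection of A with kappa[[t]]^(n+1): the cone over the closure. *)
Definition lattice A : set 'rV[fps kappa]_n.+1 := [set w | toK w \in A].

Definition lattice_basis A (X : seq 'rV[fps kappa]_n.+1) : Prop :=
  module_basis [set: fps kappa] (lattice A) [set 0] X.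

(* The fibre at t = 0 of the closure of A, i.e. the reduction mod t of the
   lattice of A. *)
Definition special_fibre A : {vspace Vk} :=
  xget 0%VS [set W : {vspace Vk} | [set x | x \in W] = red @` lattice A].

Definition is_clim A B (phi : homdet kappa n) : Prop :=
  let As := special_fibre A in
  let Bs := special_fibre B in
  is_homdet (As :&: Bs) (As + Bs) phi /\
  forall X Y, lattice_basis A X -> lattice_basis B Y ->
    star As Bs (map red X) (map red Y) phi = fps_reg (wedge (X ++ Y)).

(* A quasi-projective curve C over kappa with a local coordinate t at a
   kappa-point p is described by its function field, embedded in kappa((t)) by
   expansion at p: a subfield containing kappa and t, finitely generated over
   kappa and of transcendence degree one. *)
Definition is_function_field (E : {pred K}) : Prop :=
  [/\ GRing.divring_closed E,
      forall c, laurent_const c \in E,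
      laurent_t kappa \in E,
      exists2 X : seq K, {subset X <= E} &
        forall E' : {pred K}, GRing.divring_closed E' ->
          (forall c, laurent_const c \in E') -> {subset X <= E'} ->
          {subset E <= E'} &
      forall f, f \in E -> exists2 P : {poly {poly kappa}}, P != 0 &
        root (map_poly (fun p : {poly kappa} =>
          (map_poly (@laurent_const kappa) p).[laurent_t kappa]) P) f].

Definition defined_over (E : {pred K}) A : Prop :=
  exists2 X : seq VK, basis_of A X & forall x j, x \in X -> x 0 j \in E.

Definition algebraic_family (A B : 'I_2 -> {vspace VK}) : Prop :=
  exists2 E : {pred K}, is_function_field E &
    forall i, defined_over E (A i) /\ defined_over E (B i).

End Family.

Section NumberField.
Variable kappa : fieldExtType rat.
Implicit Types (x y : kappa) (I J : set kappa).

Definition ring_of_integers : set kappa :=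
  [set x | integralOver (intr : int -> kappa) x].

Local Notation O := ring_of_integers.

Definition integer_units : set kappa := [set x | [/\ x != 0, O x & O x^-1]].

Definition nonzero_ideal I : Prop :=
  [/\ I `<=` O, (exists2 x, I x & x != 0),
      (forall x y, I x -> I y -> I (x + y)) &
      (forall a x, O a -> I x -> I (a * x))].

Definition same_ideal_class I J : Prop :=
  exists a b, [/\ O a, O b, a != 0, b != 0 &
                [set a * x | x in I] = [set b * y | y in J]].

Definition class_number_one : Prop :=
  forall I J, nonzero_ideal I -> nonzero_ideal J -> same_ideal_class I J.

(* The determinant is that of multiplication by x on the Q-vector space kappa. *)
Definition abs_norm x : rat :=
  `|\det (\matrix_(i < \dim {:kappa}, j < \dim {:kappa})
      coord (vbasis {:kappa}) j (x * (vbasis {:kappa})`_i))|.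

(* Elements of kappa^* / O^* are represented as cosets, i.e. sets. *)
Definition class_norm (X : set kappa) : rat := abs_norm (xget 1 X).

Section Arithmetic.
Variable n : nat.
Local Notation V := 'rV[kappa]_n.+1.
Implicit Types A B : {vspace V}.

Definition std_lattice : set V := [set x | forall j, O (x 0 j)].

Definition integral_part A : set V := [set x | x \in A] `&` std_lattice.

Definition saturation (M : set V) : set V :=
  std_lattice `&` [set x | exists r, [/\ O r, r != 0 & M (r *: x)]].

(* phi generates Hom_O (det S_O, det Q_O): it maps the generator /\s of det S_O
   to a unit times the generator /\q of det Q_O. *)
Definition is_car A B (phi : homdet kappa n) : Prop :=
  is_homdet (A :&: B) (A + B) phi /\
  exists s q,
    [/\ module_basis O (integral_part (A :&: B)) [set 0] s,
        module_basis O std_lattice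
          (saturation [set x + y | x in integral_part A & y in integral_part B])
          q &
        integer_units (phi s q)].

(* The next two are cosets of O^*, as c_ar is defined up to units. *)
Definition arithmetic_cross_ratio (As Bs : 'I_2 -> {vspace V}) : set kappa :=
  [set x | exists2 c, (forall i j, is_car (As i) (Bs j) (c i j)) &
           x = degenerate_cross_ratio As Bs c].

Definition clim_over_car (A B : 'I_2 -> {vspace 'rV[laurent kappa]_n.+1}) :
    set kappa :=
  let As i := special_fibre (A i) in
  let Bs j := special_fibre (B j) in
  [set y | exists clim car, [/\ forall i j, is_clim (A i) (B j) (clim i j),
             forall i j, is_car (As i) (Bs j) (car i j) &
             y = tensor_ratio As Bs clim car]].

End Arithmetic.
End NumberField.

Section Complexification.
Variables (R : realType) (kappa : fieldExtType rat).
Local Notation C := R[i].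

Definition cabs (z : C) : R := ComplexField.Normc.normc z.

Definition embeddings : set (kappa -> C) :=
  [set sigma : kappa -> C | exists tau : {rmorphism kappa -> C}, sigma = tau].

Section OneEmbedding.
Variable sigma : kappa -> C.

(* C^o carries the topology and the normed module structure of C. *)
Definition fps_series (f : fps kappa) (z : C) : nat -> C^o :=
  series (fun m => sigma (fps_coef f m) * z ^+ m : C^o).

Definition fps_converges (r : R) (f : fps kappa) : Prop :=
  forall z, cabs z < r -> cvgn (fps_series f z).

Definition fps_eval (f : fps kappa) (z : C) : C := limn (fps_series f z).

Definition plane_at (n : nat) (X : seq 'rV[fps kappa]_n.+1) (z : C) :
    {vspace 'rV[C]_n.+1} :=
  <<[seq map_mx (fps_eval^~ z) w | w <- X]>>%VS.

(* v = u(0), where z^m u(z) is the cross-ratio of the complexified family. *)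
Definition is_limit_period (k n : nat)
    (A B : 'I_2 -> {vspace 'rV[laurent kappa]_n.+1}) (v : C) : Prop :=
  exists (r : R) (m : int) (u : C -> C)
         (a b : 'I_2 -> seq 'rV[fps kappa]_n.+1),
  [/\ 0 < r,
      forall i, basis_of (A i) (map (@toK _ _) (a i)) /\
                basis_of (B i) (map (@toK _ _) (b i)),
      forall i w j, (w \in a i) || (w \in b i) -> fps_converges r (w 0 j),
      [/\ forall z : C, cabs z < r -> derivable (u : C^o -> C^o) z 1,
          u 0 = v & v != 0] &
      forall z : C, 0 < cabs z < r ->
        let Az i := plane_at (a i) z in
        let Bz j := plane_at (b j) z in
        complementary k Az Bz /\ cross_ratio Az Bz = z ^ m * u z].

(* Elements of R / log|O^*|_sigma, as cosets: the class of a real number, and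
   the logarithm of an element of kappa^* / O^*. *)
Definition real_class (x : R) : set R :=
  [set x + ln (cabs (sigma e)) | e in @integer_units kappa].

Definition log_class (X : set kappa) : set R :=
  [set ln (cabs (sigma x)) | x in X].

End OneEmbedding.
End Complexification.

(* Main.v *)
Require Import Defs.
From HB Require Import structures.
From mathcomp Require Import all_boot all_order all_algebra all_field.
From mathcomp Require Import complex ring.
From mathcomp Require Import all_classical all_reals all_analysis.

Set Implicit Arguments.
Unset Strict Implicit.
Unset Printing Implicit Defensive.

Import Order.TTheory GRing.Theory Num.Theory.
Import numFieldNormedType.Exports.

Local Open Scope ring_scope.
Local Open Scope classical_set_scope.

(** The wedge products of lattice bases of A_i and B_j are non-zero power series;
    let rho be the double ratio of their leading coefficients.  Evaluated on the
    reductions of these bases, (a, b, c_lim,ij) has by definition the leading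
    coefficient as its image, so rho is the cross-ratio for c_lim, that is, the
    one for c_ar times the ratio of the two tensors.  The cross-ratio of the
    complexified family is a power of z times a function with limit sigma(rho),
    so u_sigma(0) = sigma(rho).  Saturated submodules of a free module over a
    PID (kappa[[t]], resp. O_kappa) are direct summands, whence the existence of
    c_lim and c_ar, and the choices of c_ar differ by units.  The summed formula
    holds because the product of the conjugates of rho is its norm, and units
    have norm of absolute value 1. *)

(** * Wedge products and changes of bases *)

Section WedgeRing.
Variables (S : comNzRingType) (n : nat).
Implicit Types X Y a b x y : seq 'rV[S]_n.+1.

Lemma wedge_mat p (T : 'M[S]_p) X Y : p = n.+1 ->
  (forall i : 'I_p, X`_i = \sum_(j < p) T i j *: Y`_j) ->
  wedge X = \det T * wedge Y.
Proof.
move=> pn; subst p => XY; rewrite /wedge -det_mulmx.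
congr (\det _); apply/matrixP => i j; rewrite !mxE XY summxE.
by apply: eq_bigr => k _; rewrite !mxE.
Qed.

Lemma wedge_catl p (M : 'M[S]_p) a a' y :
  (p <= n.+1)%N -> size a = p -> size a' = p ->
  (forall i : 'I_p, a`_i = \sum_(j < p) M i j *: a'`_j) ->
  wedge (a ++ y) = \det M * wedge (a' ++ y).
Proof.
move=> pn sa sa' aa'.
rewrite (@wedge_mat (p + (n.+1 - p)) (block_mx M 0 0 1%:M) _ (a' ++ y)).
- by rewrite det_lblock det1 mulr1.
- by rewrite subnKC.
move=> i; rewrite big_split_ord /=; case: (splitP i) => i' ii'.
  have -> : i = lshift _ i' by apply: val_inj.
  rewrite /= nth_cat sa ltn_ord aa' [X in _ + X]big1 ?addr0.
    apply: eq_bigr => j _.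
    by rewrite block_mxEul nth_cat sa' ltn_ord.
  by move=> j _; rewrite block_mxEur mxE scale0r.
have -> : i = rshift _ i' by apply: val_inj.
rewrite /= nth_cat sa ltnNge leq_addr /= addKn [X in X + _]big1 ?add0r.
  rewrite (bigD1 i') //= block_mxEdr mxE eqxx scale1r big1 ?addr0.
    by rewrite nth_cat sa' ltnNge leq_addr /= addKn.
  by move=> j /negPf ji; rewrite block_mxEdr mxE eq_sym ji scale0r.
by move=> j _; rewrite block_mxEdl mxE scale0r.
Qed.

Lemma wedge_catr q (N : 'M[S]_q) b b' x :
  (size x + q)%N = n.+1 ->
  (forall i : 'I_q, b`_i = \sum_(j < q) N i j *: b'`_j) ->
  wedge (x ++ b) = \det N * wedge (x ++ b').
Proof.
move=> xq bb'.
rewrite (@wedge_mat (size x + q) (block_mx 1%:M 0 0 N) _ (x ++ b')) //.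
  by rewrite det_lblock det1 mul1r.
move=> i; rewrite big_split_ord /=; case: (splitP i) => i' ii'.
  have -> : i = lshift _ i' by apply: val_inj.
  rewrite /= nth_cat ltn_ord [X in _ + X]big1 ?addr0.
    rewrite (bigD1 i') //= block_mxEul mxE eqxx scale1r big1 ?addr0.
      by rewrite nth_cat ltn_ord.
    by move=> j /negPf ji; rewrite block_mxEul mxE eq_sym ji scale0r.
  by move=> j _; rewrite block_mxEur mxE scale0r.
have -> : i = rshift _ i' by apply: val_inj.
rewrite /= nth_cat ltnNge leq_addr /= addKn [X in X + _]big1 ?add0r.
  rewrite bb'; apply: eq_bigr => j _.
  by rewrite block_mxEdr nth_cat ltnNge leq_addr /= addKn.
by move=> j _; rewrite block_mxEdl mxE scale0r.
Qed.

End WedgeRing.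

Section ChangeOfBasis.
Variables (F : fieldType) (n : nat).
Local Notation V := 'rV[F]_n.+1.
Implicit Types (U A B W : {vspace V}) (X Y Z a b s q x y : seq V).

Lemma dimv_rV_le U : (\dim U <= n.+1)%N.
Proof. by have := dimvS (subvf U); rewrite dimvf /dim /= mul1n. Qed.

Lemma basis_size U X : basis_of U X -> size X = \dim U.
Proof. by move=> bX; rewrite -(@size_basis _ _ _ _ (in_tuple X) bX) ?size_tuple. Qed.

Lemma basis_coordE U X Y (i : nat) : basis_of U X -> basis_of U Y ->
  (i < size X)%N ->
  X`_i = \sum_(j < size Y) coord (in_tuple Y) j X`_i *: Y`_j.
Proof.
move=> bX bY iX; apply: coord_span; rewrite in_tupleE.
by rewrite (span_basis bY); apply: (basis_mem bX); rewrite mem_nth.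
Qed.

Lemma vol_mat p (M : 'M[F]_p) X Y : size Y = p -> free Y ->
  (forall i : 'I_p, X`_i = \sum_(j < p) M i j *: Y`_j) ->
  vol X Y = \det M.
Proof.
move=> pY; subst p => fY XY.
rewrite /vol; congr (\det _); apply/matrixP => i j; rewrite !mxE XY.
by rewrite (@coord_sum_free _ _ _ (in_tuple Y)).
Qed.

Lemma vol_xx X : free X -> vol X X = 1.
Proof.
move=> fX; rewrite (@vol_mat (size X) 1%:M) ?det1 // => i.
rewrite (bigD1 i) //= mxE eqxx scale1r big1 ?addr0 // => j /negPf ji.
by rewrite mxE eq_sym ji scale0r.
Qed.

Lemma vol_trans U X Y Z : basis_of U X -> basis_of U Y -> basis_of U Z ->
  vol X Z = vol X Y * vol Y Z.
Proof.
move=> bX bY bZ.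
have sXY := basis_size bX; have sY := basis_size bY; have sZ := basis_size bZ.
pose M := \matrix_(i < size Z, j < size Z)
  coord (in_tuple Y) (cast_ord (etrans sZ (esym sY)) j) X`_i.
pose N := \matrix_(i < size Z, j < size Z) coord (in_tuple Z) j Y`_i.
have EXY (i : 'I_(size Z)) : X`_i = \sum_(j < size Z) M i j *: Y`_j.
  have eYZ : size Z = size Y by rewrite sZ.
  rewrite (basis_coordE (i := i) bX bY) ?sXY -?sZ //.
  rewrite (reindex (cast_ord (etrans sZ (esym sY)))) /=; last first.
    by apply: onW_bij; exists (cast_ord (esym (etrans sZ (esym sY)))) => j;
      apply: val_inj.
  by apply: eq_bigr => j _; rewrite mxE.
have EYZ (i : 'I_(size Z)) : Y`_i = \sum_(j < size Z) N i j *: Z`_j.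
  rewrite (basis_coordE (i := i) bY bZ) ?sY -?sZ //.
  by apply: eq_bigr => j _; rewrite mxE.
rewrite (@vol_mat (size Z) (M *m N)) ?(basis_free bZ) //; last first.
  move=> i; rewrite EXY; under eq_bigr do rewrite EYZ scaler_sumr.
  rewrite exchange_big; apply: eq_bigr => j _; rewrite mxE scaler_suml.
  by apply: eq_bigr => k _; rewrite scalerA.
by rewrite det_mulmx (@vol_mat (size Z) M _ Y) ?sY ?sZ ?(basis_free bY) //.
Qed.

Lemma vol_neq0 U X Y : basis_of U X -> basis_of U Y -> vol X Y != 0.
Proof.
move=> bX bY; have := vol_trans bX bY bX; rewrite (vol_xx (basis_free bX)).
move=> e; apply/eqP => v0; move/eqP: e; rewrite v0 mul0r oner_eq0.
by [].
Qed.

Lemma vol_inv U X Y : basis_of U X -> basis_of U Y -> vol X Y = (vol Y X)^-1.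
Proof.
move=> bX bY; have := vol_trans bX bY bX; rewrite (vol_xx (basis_free bX)).
by move=> e; rewrite -[RHS]mul1r e mulfK ?(vol_neq0 bY bX).
Qed.

Lemma wedge_volL U a a' y : basis_of U a -> basis_of U a' ->
  wedge (a ++ y) = vol a a' * wedge (a' ++ y).
Proof.
move=> ba ba'; have sa := basis_size ba; have sa' := basis_size ba'.
pose M := \matrix_(i < size a', j < size a') coord (in_tuple a') j a`_i.
rewrite (@wedge_catl _ _ (size a') M a a') //.
- by rewrite sa' dimv_rV_le.
- by rewrite sa sa'.
move=> i; rewrite (basis_coordE (i := i) ba ba') ?sa -?sa' //.
by apply: eq_bigr => j _; rewrite mxE.
Qed.

Lemma wedge_volR U b b' x : basis_of U b -> basis_of U b' ->
  (size x + \dim U)%N = n.+1 ->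
  wedge (x ++ b) = vol b b' * wedge (x ++ b').
Proof.
move=> bb bb'; have sb := basis_size bb; have sb' := basis_size bb'; move=> xU.
pose M := \matrix_(i < size b', j < size b') coord (in_tuple b') j b`_i.
rewrite (@wedge_catr _ _ (size b') M b b') ?sb' //.
move=> i; rewrite (basis_coordE (i := i) bb bb') ?sb -?sb' //.
by apply: eq_bigr => j _; rewrite mxE.
Qed.

Lemma wedge_neq0 X : basis_of fullv X -> wedge X != 0.
Proof.
move=> bX; have sX : size X = n.+1.
  by rewrite (basis_size bX) dimvf /dim /= mul1n.
pose E : seq V := [seq delta_mx 0 i | i : 'I_n.+1].
have EE (i : 'I_n.+1) : E`_i = delta_mx 0 i.
  by rewrite (nth_map i) ?size_enum_ord // nth_ord_enum.
have wE : wedge E = 1.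
  rewrite /wedge -(det1 _ n.+1); congr (\det _); apply/matrixP => i j.
  by rewrite !mxE EE mxE eqxx eq_sym.
pose T := \matrix_(i < size X, j < size X) coord (in_tuple X) j E`_i.
have ET (i : 'I_(size X)) : E`_i = \sum_(j < size X) T i j *: X`_j.
  rewrite {1}(coord_span (X := in_tuple X) (v := E`_i)).
    by apply: eq_bigr => j _; rewrite mxE.
  by rewrite in_tupleE (span_basis bX) memvf.
have := wedge_mat sX ET; rewrite wE => e.
by apply/eqP => w0; move/eqP: e; rewrite w0 mulr0 oner_eq0.
Qed.

Lemma basis_cat_cap0 U W x y : (U :&: W = 0)%VS -> basis_of U x ->
  basis_of W y -> basis_of (U + W) (x ++ y).
Proof. by move=> UW bx by_; apply: cat_basis => //; apply/directv_addP. Qed.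

Lemma quotient_basis_compl W q : basis_of (W^C) q -> quotient_basis W q.
Proof.
move=> bq; rewrite /quotient_basis -(addv_complf W).
by apply: basis_cat_cap0; rewrite ?capv_compl ?vbasisP.
Qed.

Lemma star_basisB A B :
  basis_of B (vbasis (B :\: A) ++ vbasis (A :&: B)).
Proof.
rewrite -{1}(addv_diff_cap B A) (capvC A B).
apply: basis_cat_cap0; rewrite ?vbasisP //.
apply/eqP; rewrite -subv0 -(capv_diff B A) subv_cap capvSl /=.
by rewrite (subv_trans (capvSr _ _)) // capvSr.
Qed.

Lemma star_basisV A B a : basis_of A a ->
  basis_of fullv (a ++ vbasis (B :\: A) ++ vbasis (A + B)^C).
Proof.
move=> ba; rewrite catA -(addv_complf (A + B)).
apply: basis_cat_cap0; rewrite ?capv_compl ?vbasisP //.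
have -> : (A + B = A + (B :\: A))%VS by rewrite addvC -addv_diff addvC.
by apply: basis_cat_cap0; rewrite ?vbasisP // capvC capv_diff.
Qed.

Lemma starE A B a b phi :
  let s := vbasis (A :&: B) in let q := vbasis (A + B)^C in
  star A B a b phi = phi s q * star A B a b (fun _ _ => 1).
Proof. by rewrite /star /= mulr1 -mulrA mulrCA. Qed.

Lemma star1_neq0 A B a b : basis_of A a -> basis_of B b ->
  star A B a b (fun _ _ => 1) != 0.
Proof.
move=> ba bb; rewrite /star mulr1 mulf_neq0 //.
  exact: (vol_neq0 bb (star_basisB A B)).
exact/wedge_neq0/star_basisV.
Qed.

Lemma star_vol A B a a' b b' phi :
  basis_of A a -> basis_of A a' -> basis_of B b -> basis_of B b' ->
  star A B a b phi = vol a a' * vol b b' * star A B a' b' phi.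
Proof.
move=> ba ba' bb bb'; rewrite /star (wedge_volL _ ba ba').
rewrite (vol_trans bb bb' (star_basisB A B)).
by ring.
Qed.

Lemma homdet_exists W U s0 q0 (c : F) :
  basis_of U s0 -> quotient_basis W q0 ->
  exists2 phi : homdet F n, is_homdet U W phi & phi s0 q0 = c.
Proof.
move=> bs0 bq0; pose w := vbasis W.
exists (fun s q => c * vol s s0 / vol (w ++ q) (w ++ q0)); last first.
  by rewrite !vol_xx ?divr1 ?mulr1 // ?(basis_free bs0) ?(basis_free bq0).
move=> s s' q q' bs bs' bq bq'.
rewrite (vol_trans bs' bs bs0) (vol_trans bq' bq bq0).
by field; rewrite (vol_neq0 bq' bq) (vol_neq0 bq bq0).
Qed.

Lemma homdet_neq0 W U phi s s' q q' : is_homdet U W phi ->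
  basis_of U s -> basis_of U s' -> quotient_basis W q ->
  quotient_basis W q' -> phi s q != 0 -> phi s' q' != 0.
Proof.
move=> hphi bs bs' bq bq' h0.
have : phi s' q' * vol (vbasis W ++ q') (vbasis W ++ q) != 0.
  by rewrite (hphi s s' q q') // mulf_neq0 // (vol_neq0 bs' bs).
by rewrite mulf_eq0 negb_or => /andP[].
Qed.

Lemma complementary_basis k (A B : 'I_2 -> {vspace V}) i j a b :
  complementary k A B -> basis_of (A i) a -> basis_of (B j) b ->
  basis_of fullv (a ++ b).
Proof.
move=> [dA dB AB0] ba bb.
have kn : (k <= n)%N by have := dimv_rV_le (A 0); rewrite dA ltnS.
have -> : fullv = (A i + B j)%VS.
  apply/eqP; rewrite eq_sym -dimv_leqif_eq ?subvf // dimv_disjoint_sum //.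
  by rewrite dA dB dimvf /dim /= mul1n addSn subnKC.
exact: basis_cat_cap0.
Qed.

Lemma cross_ratio_basis k (A B : 'I_2 -> {vspace V}) (a b : 'I_2 -> seq V) :
  complementary k A B ->
  (forall i, basis_of (A i) (a i)) -> (forall i, basis_of (B i) (b i)) ->
  let w i j := wedge (a i ++ b j) in
  cross_ratio A B = (w 0 0 / w 0 1) * (w 1 1 / w 1 0).
Proof.
move=> cAB ba bb /=; case: (cAB) => dA dB _.
have kn : (k <= n)%N.
  by have := dimv_rV_le (A 0); rewrite dA ltnS.
have E i j : wedge (vbasis (A i) ++ vbasis (B j)) =
    vol (vbasis (A i)) (a i) * vol (vbasis (B j)) (b j) * wedge (a i ++ b j).
  rewrite (wedge_volL _ (vbasisP (A i)) (ba i)).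
  rewrite (wedge_volR (vbasisP (B j)) (bb j)) ?mulrA //.
  by rewrite (basis_size (ba i)) dA dB addSn subnKC.
rewrite /cross_ratio !E.
have va i := vol_neq0 (vbasisP (A i)) (ba i).
have vb i := vol_neq0 (vbasisP (B i)) (bb i).
move: (va 0) (va 1) (vb 0) (vb 1) => va0 va1 vb0 vb1.
have w0 i j := wedge_neq0 (complementary_basis cAB (ba i) (bb j)).
by field; rewrite ?va0 ?va1 ?vb0 ?vb1 ?w0.
Qed.

End ChangeOfBasis.

(** * Saturated submodules over a principal ideal domain *)

Definition pid_in (F : fieldType) (O : set F) : Prop :=
  [/\ O 1, (forall x y, O x -> O y -> O (x - y)),
      (forall x y, O x -> O y -> O (x * y)),
      (forall x, exists r, [/\ O r, r != 0 & O (r * x)]) &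
      forall I : set F, I `<=` O -> (exists2 x, I x & x != 0) ->
        (forall x y, I x -> I y -> I (x + y)) ->
        (forall a x, O a -> I x -> I (a * x)) ->
        exists2 d, I d & forall x, I x -> exists2 c, O c & x = c * d].

Section Saturated.
Variables (F : fieldType) (O : set F).
Hypothesis pidO : pid_in O.
Let O1 : O 1. Proof. by case: pidO. Qed.
Let OB x y : O x -> O y -> O (x - y). Proof. by case: pidO => _ + _ _ _; apply. Qed.
Let OM x y : O x -> O y -> O (x * y). Proof. by case: pidO => _ _ + _ _; apply. Qed.

Lemma pid0 : O 0. Proof. by rewrite -(subrr 1); apply: OB. Qed.
Lemma pidN x : O x -> O (- x).
Proof. by move=> Ox; rewrite -sub0r; apply: OB => //; exact: pid0. Qed.
Lemma pidD x y : O x -> O y -> O (x + y).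
Proof. by move=> Ox Oy; rewrite -(opprK y); apply: OB => //; exact: pidN. Qed.

Lemma pid_sum (I : Type) (r : seq I) (P : pred I) (G : I -> F) :
  (forall i, O (G i)) -> O (\sum_(i <- r | P i) G i).
Proof.
by move=> OG; elim/big_ind: _ => //; [exact: pid0|exact: pidD].
Qed.

Lemma pid_det p (M : 'M[F]_p) : (forall i j, O (M i j)) -> O (\det M).
Proof.
have sgnO (b : bool) : O ((-1) ^+ b) by case: b; rewrite ?expr1 //; apply: pidN.
move=> OMij; apply: pid_sum => s; apply: OM; first exact: sgnO.
by elim/big_ind: _ => //; exact: OM.
Qed.

Lemma pid_denominator (s : seq F) :
  exists r, [/\ O r, r != 0 & forall x, x \in s -> O (r * x)].
Proof.
elim: s => [|y s [r [Or r0 rs]]]; first by exists 1; rewrite oner_neq0.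
have [t [Ot t0 ty]] : exists r, [/\ O r, r != 0 & O (r * y)].
  by case: pidO => _ _ _ + _; apply.
exists (r * t); split; [exact: OM|exact: mulf_neq0|move=> x].
rewrite inE => /predU1P[->|xs]; first by rewrite -mulrA; apply: OM.
by rewrite mulrAC mulrC; apply: OM => //; apply: rs.
Qed.

Variable n : nat.
Local Notation V := 'rV[F]_n.+1.
Implicit Types U W : {vspace V}.

Definition int_vec (x : V) : Prop := forall j, O (x 0 j).

Lemma int_vecB x y : int_vec x -> int_vec y -> int_vec (x - y).
Proof. by move=> ix iy j; rewrite !mxE; apply: OB. Qed.

Lemma int_vecZ c x : O c -> int_vec x -> int_vec (c *: x).
Proof. by move=> Oc ix j; rewrite !mxE; apply: OM. Qed.

Lemma int_vecD x y : int_vec x -> int_vec y -> int_vec (x + y).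
Proof. by move=> ix iy j; rewrite !mxE; apply: pidD. Qed.

Lemma int_vec_sum (I : Type) (r : seq I) (G : I -> V) :
  (forall i, int_vec (G i)) -> int_vec (\sum_(i <- r) G i).
Proof.
move=> iG; elim/big_ind: _ => //; last exact: int_vecD.
by move=> j; rewrite mxE; exact: pid0.
Qed.

Lemma int_vec_denominator (x : V) :
  exists r, [/\ O r, r != 0 & int_vec (r *: x)].
Proof.
have [r [Or r0 rx]] := pid_denominator [seq x 0 j | j : 'I_n.+1].
exists r; split=> // j; rewrite mxE; apply: rx.
by apply/mapP; exists j; rewrite // mem_enum.
Qed.

Lemma linear_separation U W : ~~ (U <= W)%VS ->
  exists2 g : 'Hom(V, 'M[F]_(1, 1)),
    (W <= lker g)%VS & exists2 x, x \in U & g x 0 0 != 0.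
Proof.
move=> /subvPn[x xU xW].
pose h := daddv_pi W^C W.
have capW : (W :&: W^C = 0)%VS by rewrite capv_compl.
have capW' : (W^C :&: W = 0)%VS by rewrite capvC.
have hx : h x != 0.
  apply: contraNneq xW => hx0.
  have := daddv_pi_add (w := x) capW'; rewrite addvC addv_complf memvf.
  by rewrite -/h hx0 add0r => /(_ isT) <-; exact: memv_pi.
have [j hxj] : exists j, h x 0 j != 0.
  by case/rV0Pn: hx => j ?; exists j.
exists (linfun (col j) \o h)%VF; last first.
  by exists x; rewrite // comp_lfunE lfunE /= mxE.
apply/subvP => y yW; rewrite memv_ker comp_lfunE lfunE /=.
have -> : h y = 0.
  have := daddv_pi_add (w := y) capW; rewrite addv_complf memvf.
  by rewrite daddv_pi_id // => /(_ isT)/(canRL (addKr y)); rewrite addNr.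
by rewrite linear0.
Qed.

Lemma saturated_basis W U : (W <= U)%VS ->
  exists q : seq V, [/\ basis_of U (vbasis W ++ q),
    (forall x, x \in q -> int_vec x) &
    forall x, x \in U -> int_vec x -> exists2 c : nat -> F,
      forall i, O (c i) & x - \sum_(i < size q) c i *: q`_i \in W].
Proof.
have [m] := ubnP (\dim U); elim: m U => // m IH U; rewrite ltnS => Um WU.
have [UW|] := boolP (U <= W)%VS.
  have -> : U = W by apply/eqP; rewrite eqEsubv UW.
  exists [::]; split=> //; first by rewrite cats0 vbasisP.
  move=> x xW _; exists (fun=> 0); first by move=> _; exact: pid0.
  by rewrite big_ord0 subr0.
move=> /linear_separation[g Wg [x0 x0U gx0]].
have gE x : g x = (g x 0 0)%:M.
  by apply/matrixP => i j; rewrite !ord1 mxE eqxx mulr1n.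
pose f x := g x 0 0.
have fD x y : f (x + y) = f x + f y by rewrite /f linearD mxE.
have fB x y : f (x - y) = f x - f y by rewrite /f linearB !mxE.
have fZ c x : f (c *: x) = c * f x by rewrite /f linearZ !mxE.
have [r [Or r0 rf]] := pid_denominator [seq f (delta_mx 0 j) | j : 'I_n.+1].
pose I := [set r * f x | x in [set x | x \in U /\ int_vec x]].
have fsum (J : Type) (s : seq J) (G : J -> V) :
    f (\sum_(i <- s) G i) = \sum_(i <- s) f (G i).
  elim: s => [|a s IHs]; first by rewrite !big_nil /f linear0 mxE.
  by rewrite !big_cons fD IHs.
have IO : I `<=` O.
  move=> _ [x [xU ix] <-]; rewrite (row_sum_delta x) fsum mulr_sumr.
  apply: pid_sum => j; rewrite fZ mulrCA; apply: OM => //; apply: rf.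
  by apply/mapP; exists j; rewrite // mem_enum.
have I0 : exists2 x, I x & x != 0.
  have [t [Ot t0 tx]] := int_vec_denominator x0.
  exists (r * f (t *: x0)); first by exists (t *: x0) => //; rewrite /= memvZ.
  by rewrite fZ !mulf_neq0.
have ID x y : I x -> I y -> I (x + y).
  move=> [x' [x'U ix'] <-] [y' [y'U iy'] <-]; exists (x' + y').
    by rewrite /= memvD //; split=> //; apply: int_vecD.
  by rewrite fD mulrDr.
have IM a x : O a -> I x -> I (a * x).
  move=> Oa [x' [x'U ix'] <-]; exists (a *: x').
    by rewrite /= memvZ //; split=> //; apply: int_vecZ.
  by rewrite fZ mulrCA.
have [d [v [vU iv] rv] dI] : exists2 d, I d &
    forall x, I x -> exists2 c, O c & x = c * d.
  by case: pidO => _ _ _ _; apply.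
have fI x : x \in U -> int_vec x -> exists2 c, O c & f x = c * f v.
  move=> xU ix; have [|c Oc e] := dI (r * f x); first by exists x.
  by exists c => //; apply: (mulfI r0); rewrite e -rv mulrCA.
have fv0 : f v != 0.
  case: I0 => _ [x [xU ix] <-] rfx; have [c _ e] := fI x xU ix.
  by apply: contraNneq rfx => fv; rewrite e fv !mulr0.
pose U' := (U :&: lker g)%VS.
have memU' x : (x \in U') = (x \in U) && (f x == 0).
  rewrite memv_cap memv_ker gE -/(f x); congr (_ && _).
  apply/eqP/eqP => [/matrixP/(_ 0 0)|->]; last by rewrite raddf0.
  by rewrite !mxE eqxx mulr1n.
have vU' : v \notin U' by rewrite memU' negb_and fv0 orbT.
have UE : U = (U' + <[v]>)%VS.
  apply/eqP; rewrite eqEsubv subv_add capvSl -memvE vU !andbT.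
  apply/subvP => x xU; rewrite -(subrK ((f x / f v) *: v) x).
  apply: memv_add; last by rewrite memvZ // memv_line.
  by rewrite memU' fB fZ divfK // subrr eqxx memvB ?memvZ.
have capU' : (U' :&: <[v]> = 0)%VS.
  apply/eqP; rewrite -subv0; apply/subvP => x; rewrite memv_cap.
  move=> /andP[+ /vlineP[c xE]]; rewrite memU' => /andP[_].
  rewrite xE fZ mulf_eq0 (negPf fv0) orbF => /eqP ->.
  by rewrite scale0r mem0v.
have dimU' : (\dim U' < m)%N.
  rewrite (leq_trans _ Um) // UE dimv_disjoint_sum // dim_vline.
  have -> : v != 0 by apply: contraNneq vU' => ->; rewrite mem0v.
  by rewrite addn1.
have [|q' [bq' iq' cq']] := IH U' dimU'.
  by rewrite subv_cap WU.
exists (q' ++ [:: v]); split.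
- rewrite catA [X in basis_of X]UE; apply: cat_basis => //.
    exact/directv_addP.
  apply: seq1_basis; apply: contraNneq vU' => ->; exact: mem0v.
- by move=> x; rewrite mem_cat inE => /orP[/iq'//|/eqP->].
move=> x xU ix; have [c Oc fx] := fI x xU ix.
have [||c' Oc' e] := cq' (x - c *: v).
- by rewrite memU' memvB ?memvZ //= fB fZ fx subrr.
- by apply: int_vecB => //; apply: int_vecZ.
exists (fun i => if (i < size q')%N then c' i else c).
  by move=> i; case: ifP.
rewrite size_cat /= addn1 big_ord_recr /= ltnn nth_cat ltnn subnn /=.
rewrite [X in x - (X + _)](_ : _ = \sum_(i < size q') c' i *: q'`_i).
  by rewrite opprD addrA addrAC.
by apply: eq_bigr => i _; rewrite nth_cat ltn_ord.
Qed.

End Saturated.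

(** * Formal power series *)

Section PowerSeries.
Variable F : fieldType.
Implicit Types f g h : fps F.

Definition fps_coef0 f : F := fps_coef f 0.

Fact fps_coef0_zmod : zmod_morphism fps_coef0.
Proof. by []. Qed.
Fact fps_coef0_monoid : monoid_morphism fps_coef0.
Proof. by split=> // f g; rewrite /fps_coef0 /= big_ord_recl big_ord0 addr0. Qed.
HB.instance Definition _ :=
  GRing.isZmodMorphism.Build (fps F) F fps_coef0 fps_coef0_zmod.
HB.instance Definition _ :=
  GRing.isMonoidMorphism.Build (fps F) F fps_coef0 fps_coef0_monoid.

Lemma fps_coefD f g m : fps_coef (f + g) m = fps_coef f m + fps_coef g m.
Proof. by []. Qed.
Lemma fps_coefB f g m : fps_coef (f - g) m = fps_coef f m - fps_coef g m.
Proof. by []. Qed.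
Lemma fps_coefM f g m :
  fps_coef (f * g) m = \sum_(i < m.+1) fps_coef f i * fps_coef g (m - i).
Proof. by []. Qed.
Lemma fps_coef_0 m : fps_coef (0 : fps F) m = 0.
Proof. by rewrite /= if_same. Qed.
Lemma fps_coef_1 m : fps_coef (1 : fps F) m = (m == 0%N)%:R.
Proof. by rewrite /=; case: eqP. Qed.

Lemma fps_coef_sum (I : Type) (r : seq I) (P : pred I) (G : I -> fps F) m :
  fps_coef (\sum_(i <- r | P i) G i) m = \sum_(i <- r | P i) fps_coef (G i) m.
Proof.
elim: r => [|i r IH]; first by rewrite !big_nil fps_coef_0.
by rewrite !big_cons; case: ifP => // _; rewrite fps_coefD IH.
Qed.

Definition fps_ord_ge f m : Prop := forall i, (i < m)%N -> fps_coef f i = 0.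

Lemma fps_ord_geM f g m p : fps_ord_ge f m -> fps_ord_ge g p ->
  fps_ord_ge (f * g) (m + p) /\
  fps_coef (f * g) (m + p) = fps_coef f m * fps_coef g p.
Proof.
move=> fm gp; split=> [i imp|].
  rewrite fps_coefM big1 // => -[j /= ji] _.
  have [jm|mj] := ltnP j m; first by rewrite fm // mul0r.
  rewrite (gp (i - j)%N) ?mulr0 // ltn_subLR; last by rewrite -ltnS.
  by rewrite (leq_trans imp) // leq_add2r.
rewrite fps_coefM (bigD1 (inord m)) //= inordK ?ltnS ?leq_addr // addKn.
rewrite big1 ?addr0 // => -[j /= jmp].
rewrite -val_eqE /= inordK ?ltnS ?leq_addr // => jm.
case: (ltngtP j m) jm => // jm _; first by rewrite fm // mul0r.
by rewrite (gp (m + p - j)%N) ?mulr0 // ltn_subLR ?ltn_add2r // -ltnS.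
Qed.

Lemma fps_valP f : f != 0 ->
  fps_coef f (fps_val f) != 0 /\ fps_ord_ge f (fps_val f).
Proof.
move=> f0; rewrite /fps_val; case: xgetP => [m _ []//|noval].
have exm : exists m, fps_coef f m != 0.
  apply: contrapT => /forallNP fn; move/eqP: f0; apply; apply: fpsP => m.
  by move/negP/negPn/eqP: (fn m) => ->; rewrite fps_coef_0.
case: (ex_minnP exm) => m fm mmin; case: (noval m); split=> // i im.
by apply/eqP; apply: contraTT im => fi; rewrite -leqNgt mmin.
Qed.

Lemma fps_val_unique f m : fps_coef f m != 0 -> fps_ord_ge f m ->
  fps_val f = m.
Proof.
move=> fm fm'; have f0 : f != 0.
  by apply: contraNneq fm => ->; rewrite fps_coef_0.
have [fv fv'] := fps_valP f0; case: (ltngtP (fps_val f) m) => // lt.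
  by move: fv; rewrite fm' // eqxx.
by move: fm; rewrite fv' // eqxx.
Qed.

Lemma fps_regM f g : f != 0 -> g != 0 ->
  fps_reg (f * g) = fps_reg f * fps_reg g.
Proof.
move=> f0 g0; have [ff fv] := fps_valP f0; have [gg gv] := fps_valP g0.
have [ord coefE] := fps_ord_geM fv gv; rewrite /fps_reg -coefE.
by rewrite (@fps_val_unique _ (fps_val f + fps_val g)) // coefE mulf_neq0.
Qed.

Lemma fps_reg_neq0 f : f != 0 -> fps_reg f != 0.
Proof. by case/fps_valP. Qed.

Lemma fps_reg_unit f : fps_coef0 f != 0 -> fps_reg f = fps_coef0 f.
Proof. by move=> f0; rewrite /fps_reg (@fps_val_unique f 0). Qed.

Lemma fps_unit_inv f : fps_coef0 f != 0 -> exists g, f * g = 1.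
Proof.
move=> f0; pose h := 1 - fps_const (fps_coef0 f)^-1 * f.
have h1 : fps_ord_ge h 1.
  case=> // _; rewrite fps_coefB fps_coef_1 eqxx fps_coefM big_ord1 /=.
  by rewrite mulVf ?subrr.
have hX k : fps_ord_ge (h ^+ k) k.
  elim: k => [//|k IH]; rewrite exprSr -addn1.
  by case: (fps_ord_geM IH h1).
pose G m := \sum_(k < m) h ^+ k.
pose g := Fps (fun m => fps_coef (G m.+1) m).
have Gstab m p : (p < m)%N -> fps_coef (G m) p = fps_coef g p.
  move=> pm; rewrite -[RHS]/(fps_coef (G p.+1) p) /G -(subnKC pm).
  rewrite big_split_ord fps_coefD.
  rewrite -[RHS]addr0; congr (_ + _); rewrite fps_coef_sum big1 // => i _.
  by apply: hX; rewrite /= leq_addr.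
have hg : (1 - h) * g = 1.
  apply: fpsP => m.
  transitivity (fps_coef ((1 - h) * G m.+1) m).
    rewrite !fps_coefM; apply: eq_bigr => -[j /= jm] _.
    by rewrite (Gstab m.+1 (m - j)%N) // ltnS leq_subr.
  have -> : (1 - h) * G m.+1 = 1 - h ^+ m.+1.
    by rewrite -[in RHS](expr1n _ m.+1) subrXX; congr (_ * _);
      apply: eq_bigr => i _; rewrite expr1n mul1r.
  by rewrite fps_coefB hX // subr0.
exists (fps_const (fps_coef0 f)^-1 * g).
by rewrite mulrA [f * _]mulrC -[RHS]hg opprB addrC subrK.
Qed.

Lemma fps_coef_tXM m f p :
  fps_coef (fps_t F ^+ m * f) p = if (p < m)%N then 0 else fps_coef f (p - m).
Proof.
elim: m p f => [|m IH] p f; first by rewrite mul1r subn0.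
rewrite exprSr -mulrA IH ltnS; case: (ltngtP p m) => // [mp|->].
  rewrite fps_coefM -(subnSK mp) big_ord_recl /= mul0r add0r.
  rewrite big_ord_recl /= mul1r big1 ?addr0; last by move=> i _; rewrite mul0r.
  by rewrite /bump /= subSS subn0.
by rewrite subnn fps_coefM big_ord1 /= mul0r.
Qed.

Lemma fps_ord_ge_divt f m : fps_ord_ge f m ->
  f = fps_t F ^+ m * Fps (fun i => fps_coef f (i + m)).
Proof.
move=> fm; apply: fpsP => p; rewrite fps_coef_tXM.
by case: ltnP => [/fm//|mp] /=; rewrite subnK.
Qed.

Lemma fps_t_neq0 : fps_t F != 0.
Proof.
by apply/eqP => /(congr1 (fun f => fps_coef f 1))/eqP; rewrite /= oner_eq0.
Qed.

Lemma fps_divisible f g : f != 0 -> fps_ord_ge g (fps_val f) ->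
  exists c, g = c * f.
Proof.
move=> f0 gf; have [ff fv] := fps_valP f0.
set m := fps_val f in gf ff fv.
rewrite (fps_ord_ge_divt gf); set g' := Fps _.
have [h f'h] := @fps_unit_inv (Fps (fun i => fps_coef f (i + m))) ff.
exists (g' * h); rewrite [in RHS](fps_ord_ge_divt fv) mulrCA -!mulrA.
by rewrite [h * _]mulrC f'h mulr1.
Qed.

Lemma frac_denominator (x : laurent F) :
  exists d h, d != 0 /\ tofrac d * x = tofrac h.
Proof.
elim/quotW: x => x; exists (frac x).2, (frac x).1; split.
  exact: denom_ratioP.
apply/eqP; rewrite !piE /equivf /FracField.mulf.
rewrite !numden_Ratio ?mulf_neq0 ?oner_neq0 ?denom_ratioP //.
by rewrite mulr1 mul1r.
Qed.

Lemma tofrac_inj : injective (@tofrac (fps F)).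
Proof. by move=> f g /eqP; rewrite tofrac_eq => /eqP. Qed.

Lemma fps_pid : pid_in (range (@tofrac (fps F))).
Proof.
split.
- by exists 1; rewrite ?tofrac1.
- by move=> _ _ [f _ <-] [g _ <-]; exists (f - g); rewrite ?tofracB.
- by move=> _ _ [f _ <-] [g _ <-]; exists (f * g); rewrite ?tofracM.
- move=> x; have [d [h [d0 dx]]] := frac_denominator x.
  by exists (tofrac d); rewrite tofrac_eq0 dx.
move=> I IO [x Ix x0] _ _.
have exm : exists m, `[< exists f, [/\ f != 0, I (tofrac f) & fps_val f = m] >].
  have [f _ fx] := IO x Ix; exists (fps_val f); apply/asboolP; exists f.
  by rewrite fx -tofrac_eq0 fx.
case: (ex_minnP exm) => m /asboolP[f [f0 If fm]] mmin.
exists (tofrac f) => // y Iy; have [g _ gy] := IO y Iy.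
have [g0|g0] := eqVneq g 0.
  exists 0; first by exists 0; rewrite ?tofrac0.
  by rewrite mul0r -gy g0 tofrac0.
have [|c gE] := @fps_divisible f g f0.
  have [_ gv] := fps_valP g0 => i; rewrite fm => im; apply: gv.
  apply: leq_trans im _; apply: mmin; apply/asboolP; exists g.
  by rewrite gy.
by exists (tofrac c); [exists c|rewrite -tofracM -gE gy].
Qed.

End PowerSeries.

(** * Lattices and special fibres *)

Lemma wedge_map (S S' : comNzRingType) (f : {rmorphism S -> S'}) n
    (X : seq 'rV[S]_n.+1) :
  f (wedge X) = wedge (map (map_mx f) X).
Proof.
rewrite /wedge -det_map_mx; congr (\det _); apply/matrixP => i j.
rewrite !mxE; have [iX|Xi] := ltnP i (size X).
  by rewrite (nth_map 0) // mxE.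
by rewrite !nth_default ?size_map // !mxE rmorph0.
Qed.

Lemma basis_span_free (F : fieldType) (vT : vectType F) (X : seq vT) U :
  free X -> span X = U -> basis_of U X.
Proof. by move=> fX sX; rewrite /basis_of sX eqxx fX. Qed.

Lemma eq_double_ratio (F : fieldType) (p q r s p' q' r' s' : F) :
  q != 0 -> s != 0 -> q' != 0 -> s' != 0 ->
  ((p / q) * (r / s) == (p' / q') * (r' / s')) =
  (p * r * (q' * s') == p' * r' * (q * s)).
Proof.
by move=> q0 s0 q'0 s'0; rewrite !mulf_div eqr_div ?mulf_neq0.
Qed.

Lemma double_ratio_scale (F : fieldType) (p0 p1 q0 q1 w00 w01 w11 w10 : F) :
  p0 != 0 -> p1 != 0 -> q0 != 0 -> q1 != 0 ->
  w00 != 0 -> w01 != 0 -> w11 != 0 -> w10 != 0 ->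
  (p0 * q0 * w00) / (p0 * q1 * w01) * ((p1 * q1 * w11) / (p1 * q0 * w10)) =
  (w00 / w01) * (w11 / w10).
Proof. by move=> *; field; do ![apply/andP; split]. Qed.

Lemma fps_reg_double_ratio (F : fieldType) (p q r s p' q' r' s' : fps F) :
  p != 0 -> q != 0 -> r != 0 -> s != 0 ->
  p' != 0 -> q' != 0 -> r' != 0 -> s' != 0 ->
  (tofrac p / tofrac q) * (tofrac r / tofrac s) =
    (tofrac p' / tofrac q') * (tofrac r' / tofrac s') ->
  (fps_reg p / fps_reg q) * (fps_reg r / fps_reg s) =
    (fps_reg p' / fps_reg q') * (fps_reg r' / fps_reg s').
Proof.
move=> p0 q0 r0 s0 p'0 q'0 r'0 s'0 /eqP.
rewrite eq_double_ratio; try by rewrite tofrac_eq0.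
rewrite -!tofracM => /eqP/tofrac_inj/(congr1 (@fps_reg F)) e.
apply/eqP; rewrite eq_double_ratio ?fps_reg_neq0 //.
by rewrite -!fps_regM ?mulf_neq0 // e.
Qed.

Section Lattices.
Variables (F : fieldType) (n : nat).
Local Notation K := (laurent F).
Local Notation VK := 'rV[K]_n.+1.
Local Notation VR := 'rV[fps F]_n.+1.
Implicit Types (A B : {vspace VK}) (X Y a b : seq VR).

Lemma toK_inj : injective (@toK F n).
Proof.
move=> v w /matrixP vw; apply/matrixP => i j.
by have := vw i j; rewrite !mxE => /tofrac_inj.
Qed.

Lemma toKZ c (v : VR) : toK (c *: v) = tofrac c *: toK v.
Proof. by rewrite /toK map_mxZ. Qed.

Lemma toK_sum (I : Type) (r : seq I) (G : I -> VR) :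
  toK (\sum_(i <- r) G i) = \sum_(i <- r) toK (G i).
Proof. by rewrite /toK raddf_sum. Qed.

Lemma redZ c (v : VR) : red (c *: v) = fps_coef0 c *: red v.
Proof. exact: (map_mxZ (@fps_coef0 F : {rmorphism _ -> _})). Qed.

Lemma red_sum (I : Type) (r : seq I) (G : I -> VR) :
  red (\sum_(i <- r) G i) = \sum_(i <- r) red (G i).
Proof. exact: (raddf_sum (map_mx (@fps_coef0 F))). Qed.

Lemma lattice_coord A X v : lattice_basis A X -> lattice A v ->
  exists c : 'I_(size X) -> fps F, v = \sum_i c i *: X`_i.
Proof.
case=> _ /(_ v) + vA => /(_ vA)[c [[_ /eqP]]].
by rewrite subr_eq0 => /eqP ? _; exists c.
Qed.

Lemma lattice_nth A X (i : 'I_(size X)) : lattice_basis A X -> lattice A X`_i.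
Proof. by case=> + _; apply; rewrite mem_nth. Qed.

Lemma lattice_lincomb A X (c : 'I_(size X) -> fps F) : lattice_basis A X ->
  lattice A (\sum_i c i *: X`_i).
Proof.
move=> bX; rewrite /lattice /= toK_sum; apply: memv_suml => i _.
by rewrite toKZ memvZ //; exact: (lattice_nth i bX).
Qed.

Lemma lattice_free A X (c : 'I_(size X) -> fps F) : lattice_basis A X ->
  \sum_i c i *: X`_i = 0 -> forall i, c i = 0.
Proof.
move=> [_ /(_ 0)] + c0; case=> [|d [_ dU] i].
  by rewrite /lattice /= /toK map_mx0 mem0v.
transitivity (d i).
  by rewrite (dU c) // c0 subrr.
rewrite (dU (fun=> 0)) //; split=> //.
by rewrite big1 ?subrr // => j _; rewrite scale0r.
Qed.

Lemma special_fibre_basis A X : lattice_basis A X ->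
  basis_of (special_fibre A) (map (@red F n) X).
Proof.
move=> bX; set rX := map _ X.
have sfE : [set x | x \in span rX] = (@red F n) @` lattice A.
  apply/seteqP; split=> [x /=|_ [v /(lattice_coord bX)[c ->] <-] /=].
    rewrite -[rX]/(tval (map_tuple (@red F n) (in_tuple X))) => /coord_span ->.
    exists (\sum_(i < size X)
        fps_const (coord (map_tuple (@red F n) (in_tuple X)) i x) *: X`_i).
      exact: lattice_lincomb.
    rewrite red_sum; apply: eq_bigr => i _; rewrite redZ /=.
    by rewrite (nth_map 0).
  rewrite red_sum; apply: memv_suml => i _; rewrite redZ memvZ //.
  by apply: memv_span; apply: map_f; rewrite mem_nth.
have -> : special_fibre A = span rX.
  apply/vspaceP => x.
  have /= H := @xgetPex _ 0%VS [set W : {vspace 'rV[F]_n.+1} |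
    [set x | x \in W] = (@red F n) @` lattice A] (ex_intro _ (span rX) sfE).
  have := congr1 (fun S : set _ => S x) (etrans H (esym sfE)).
  by rewrite /= => e; apply/idP/idP; rewrite -[is_true _]e || rewrite [is_true _]e.
apply: basis_span_free => //.
rewrite -[rX]/(tval (map_tuple (@red F n) (in_tuple X))).
apply/freeP => k k0 i.
pose v := \sum_(i < size X) fps_const (k i) *: X`_i.
have rv0 : red v = 0.
  rewrite -[RHS]k0 red_sum; apply: eq_bigr => j _; rewrite redZ /=.
  by rewrite (nth_map 0).
pose w : VR := map_mx (fun f => Fps (fun m => fps_coef f (m + 1))) v.
have vw : v = fps_t F *: w.
  apply/matrixP => a b; rewrite !mxE -[fps_t F]expr1; apply: fps_ord_ge_divt.
  by case=> // _; have /matrixP/(_ a b) := rv0; rewrite !mxE.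
have wA : lattice A w.
  have := lattice_lincomb (fun i => fps_const (k i)) bX.
  rewrite -/v vw /lattice /= toKZ => /(memvZ (tofrac (fps_t F))^-1).
  by rewrite scalerA mulVf ?scale1r // tofrac_eq0 fps_t_neq0.
have [d wE] := lattice_coord bX wA.
have : \sum_(i < size X) (fps_const (k i) - fps_t F * d i) *: X`_i = 0.
  under eq_bigr do rewrite scalerBl -scalerA.
  by rewrite sumrB -scaler_sumr -wE -vw subrr.
move/(lattice_free bX)/(_ i)/(congr1 (@fps_coef0 F)).
rewrite rmorphB rmorphM rmorph0 /= => /eqP.
by rewrite [X in X * _](_ : _ = 0) // mul0r subr0 => /eqP.
Qed.

Lemma lattice_basis_exists A :
  exists2 X, lattice_basis A X & basis_of A (map (@toK F n) X).
Proof.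
have [q [bq iq cq]] := saturated_basis (@fps_pid F) (sub0v A).
have v0 : vbasis (0%VS : {vspace VK}) = [::] :> seq _.
  by apply: size0nil; rewrite (basis_size (vbasisP _)) dimv0.
rewrite v0 /= in bq.
have liftP (x : K) : exists f, range (@tofrac (fps F)) x -> tofrac f = x.
  have [[f _ <-]|nx] := pselect (range (@tofrac (fps F)) x).
    by exists f.
  by exists 0.
have [lift liftE] := choice liftP.
pose X := map (map_mx lift : VK -> VR) q.
have liftV (x : VK) : int_vec (range (@tofrac (fps F))) x ->
    toK (map_mx lift x) = x.
  move=> ix; apply/matrixP => i j; rewrite !mxE liftE //.
  by rewrite (ord1 i); exact: ix.
have Xq : map (@toK F n) X = q.
  by rewrite -map_comp -[RHS]map_id; apply/eq_in_map => x /iq/liftV.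
have sX : size X = size q by rewrite size_map.
clearbody X.
have Xi i : toK X`_i = q`_i.
  rewrite -[in RHS]Xq; have [iX|Xi] := ltnP i (size X); first by rewrite (nth_map 0).
  by rewrite !nth_default ?size_map // /toK map_mx0.
have free_X (c : 'I_(size X) -> fps F) :
    \sum_i c i *: X`_i = 0 -> forall i, c i = 0.
  move=> /(congr1 (@toK F n)); rewrite toK_sum /toK map_mx0.
  under eq_bigr do rewrite -/(toK _) toKZ Xi.
  have fq : free q by exact: basis_free bq.
  rewrite -{1}Xq /= in fq.
  have /freeP/(_ (fun i => tofrac (c i))) fX :
    free (map_tuple (@toK F n) (in_tuple X)) by [].
  move=> c0 i; apply: tofrac_inj; rewrite tofrac0; apply: fX => {i}.
  by rewrite -[RHS]c0; apply: eq_bigr => i _; rewrite /= Xq.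
exists X; last by rewrite Xq.
split=> [x xX|v vA].
  by apply: (basis_mem bq); rewrite -Xq map_f.
have [|c Oc] := cq (toK v) vA.
  by move=> j; exists (v 0 j); rewrite ?mxE.
rewrite memv0 subr_eq0 => /eqP vE.
have vc : v = \sum_(i < size X) lift (c i) *: X`_i.
  apply: toK_inj; rewrite toK_sum vE -sX; apply: eq_bigr => i _.
  by rewrite toKZ liftE // Xi.
exists (fun i => lift (c i)); split=> [|d [_ /= /eqP]].
  by split=> //=; rewrite -vc subrr.
rewrite subr_eq0 => /eqP vd; apply/funext => i.
apply/eqP; rewrite -subr_eq0; apply/eqP.
apply: (free_X (fun i => lift (c i) - d i)).
under eq_bigr do rewrite scalerBl.
by rewrite sumrB -vc -vd subrr.
Qed.

Lemma lattice_change A X X' : lattice_basis A X -> lattice_basis A X' ->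
  exists M : 'M[fps F]_(size X),
    [/\ size X' = size X,
        forall i : 'I_(size X), X'`_i = \sum_(j < size X) M i j *: X`_j &
        vol (map (@red F n) X') (map (@red F n) X) = fps_coef0 (\det M)].
Proof.
move=> bX bX'; have rX := special_fibre_basis bX.
have rX' := special_fibre_basis bX'.
have sX' : size X' = size X.
  by rewrite -(size_map (@red F n)) (basis_size rX') -(basis_size rX) size_map.
have /choice[M ME] : forall i : 'I_(size X), exists c : 'I_(size X) -> fps F,
    X'`_i = \sum_j c j *: X`_j.
  move=> i; apply: (lattice_coord bX); case: bX' => + _; apply.
  by rewrite mem_nth // sX'.
exists (\matrix_(i, j) M i j); split=> //.
  by move=> i; rewrite ME; apply: eq_bigr => j _; rewrite mxE.
rewrite -det_map_mx; apply: vol_mat; rewrite ?size_map ?(basis_free rX) //.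
move=> i; rewrite (nth_map 0) ?sX' // ME red_sum; apply: eq_bigr => j _.
by rewrite redZ !mxE (nth_map 0).
Qed.

Definition limit_ratio (a b : 'I_2 -> seq VR) : F :=
  let w i j := fps_reg (wedge (a i ++ b j)) in
  (w 0 0 / w 0 1) * (w 1 1 / w 1 0).

Section Configuration.
Variables (k : nat) (A B : 'I_2 -> {vspace VK}).
Hypothesis cAB : complementary k A B.

Lemma wedge_toK (X : seq VR) : tofrac (wedge X) = wedge (map (@toK F n) X).
Proof. exact: (wedge_map (@tofrac (fps F) : {rmorphism _ -> _})). Qed.

Lemma complementary_wedge_neq0 i j a b :
  basis_of (A i) (map (@toK F n) a) -> basis_of (B j) (map (@toK F n) b) ->
  wedge (a ++ b) != 0.
Proof.
move=> ba bb; rewrite -tofrac_eq0 wedge_toK map_cat; apply: wedge_neq0.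
exact: complementary_basis cAB ba bb.
Qed.

Lemma limit_ratio_basis (a b a' b' : 'I_2 -> seq VR) :
  (forall i, basis_of (A i) (map (@toK F n) (a i))) ->
  (forall i, basis_of (B i) (map (@toK F n) (b i))) ->
  (forall i, basis_of (A i) (map (@toK F n) (a' i))) ->
  (forall i, basis_of (B i) (map (@toK F n) (b' i))) ->
  limit_ratio a b = limit_ratio a' b'.
Proof.
move=> ba bb ba' bb'.
have w0 i j := complementary_wedge_neq0 (ba i) (bb j).
have w0' i j := complementary_wedge_neq0 (ba' i) (bb' j).
have K0 := cross_ratio_basis cAB ba bb.
have K0' := cross_ratio_basis cAB ba' bb'.
rewrite /= in K0 K0'.
have := etrans (esym K0) K0'; rewrite -!map_cat -!wedge_toK.
rewrite /limit_ratio /=.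
exact: fps_reg_double_ratio.
Qed.

Lemma clim_exists i j : exists phi, is_clim (A i) (B j) phi.
Proof.
have [X bX bAX] := lattice_basis_exists (A i).
have [Y bY bBY] := lattice_basis_exists (B j).
have rX := special_fibre_basis bX; have rY := special_fibre_basis bY.
set As := special_fibre _ in rX; set Bs := special_fibre _ in rY.
have [phi hphi phiE] := homdet_exists
  (fps_reg (wedge (X ++ Y)) /
     star As Bs (map (@red F n) X) (map (@red F n) Y) (fun _ _ => 1))
  (vbasisP (As :&: Bs)) (quotient_basis_compl (vbasisP (As + Bs)^C)).
exists phi; split=> // X' Y' bX' bY'.
have rX' := special_fibre_basis bX'; have rY' := special_fibre_basis bY'.
have [M [sM XM vM]] := lattice_change bX bX'.
have [N [sN YN vN]] := lattice_change bY bY'.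
have M0 : fps_coef0 (\det M) != 0 by rewrite -vM (vol_neq0 rX').
have N0 : fps_coef0 (\det N) != 0 by rewrite -vN (vol_neq0 rY').
have coef0_neq0 (f : fps F) : fps_coef0 f != 0 -> f != 0.
  by apply: contraNneq => ->; rewrite rmorph0.
have sXY : (size X + size Y)%N = n.+1.
  rewrite -(size_map (@toK F n) X) -(size_map (@toK F n) Y) -size_cat.
  by rewrite (basis_size (complementary_basis cAB bAX bBY)) dimvf /dim /= mul1n.
have leX := leq_addr (size Y) (size X); rewrite [X in (_ <= X)%N]sXY in leX.
rewrite (wedge_catl Y' leX sM erefl XM) (wedge_catr sXY YN).
have w0 := complementary_wedge_neq0 bAX bBY.
have detM := coef0_neq0 _ M0; have detN := coef0_neq0 _ N0.
rewrite !fps_regM ?mulf_neq0 //.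
rewrite (fps_reg_unit M0) (fps_reg_unit N0) -vM -vN mulrA.
rewrite (star_vol _ rX' rX rY' rY) -/As -/Bs; congr (_ * _).
by rewrite starE phiE divfK // star1_neq0.
Qed.

Lemma degenerate_cross_ratio_clim clim (a b : 'I_2 -> seq VR) :
  (forall i j, is_clim (A i) (B j) (clim i j)) ->
  (forall i, basis_of (A i) (map (@toK F n) (a i))) ->
  (forall i, basis_of (B i) (map (@toK F n) (b i))) ->
  degenerate_cross_ratio (fun i => special_fibre (A i))
    (fun j => special_fibre (B j)) clim = limit_ratio a b.
Proof.
move=> hclim ba bb.
have /choice[X /all_and2[bX bAX]] : forall i, exists X,
    lattice_basis (A i) X /\ basis_of (A i) (map (@toK F n) X).
  by move=> i; have [X ? ?] := lattice_basis_exists (A i); exists X.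
have /choice[Y /all_and2[bY bBY]] : forall i, exists X,
    lattice_basis (B i) X /\ basis_of (B i) (map (@toK F n) X).
  by move=> i; have [Z ? ?] := lattice_basis_exists (B i); exists Z.
rewrite (limit_ratio_basis ba bb bAX bBY) /degenerate_cross_ratio /limit_ratio /=.
have rX i := special_fibre_basis (bX i); have rY i := special_fibre_basis (bY i).
have sE i j : star (special_fibre (A i)) (special_fibre (B j))
    (vbasis (special_fibre (A i))) (vbasis (special_fibre (B j))) (clim i j) =
    vol (vbasis (special_fibre (A i))) (map (@red F n) (X i)) *
    vol (vbasis (special_fibre (B j))) (map (@red F n) (Y j)) *
    fps_reg (wedge (X i ++ Y j)).
  rewrite (star_vol _ (vbasisP _) (rX i) (vbasisP _) (rY j)).
  by case: (hclim i j) => _ ->.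
rewrite !sE.
have va i := vol_neq0 (vbasisP _) (rX i).
have vb i := vol_neq0 (vbasisP _) (rY i).
have w0 i j := fps_reg_neq0 (complementary_wedge_neq0 (bAX i) (bBY j)).
exact: double_ratio_scale.
Qed.

Lemma limit_ratio_neq0 (a b : 'I_2 -> seq VR) :
  (forall i, basis_of (A i) (map (@toK F n) (a i))) ->
  (forall i, basis_of (B i) (map (@toK F n) (b i))) ->
  limit_ratio a b != 0.
Proof.
move=> ba bb; rewrite /limit_ratio.
by rewrite !mulf_neq0 ?invr_eq0 // fps_reg_neq0 //; 
  apply: complementary_wedge_neq0.
Qed.

End Configuration.
End Lattices.

(** * Bases of saturated quotients and arithmetic perturbations *)

Section ModuleBases.
Variables (F : fieldType) (O : set F).
Hypothesis pidO : pid_in O.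
Variable n : nat.
Local Notation V := 'rV[F]_n.+1.
Implicit Types (U W : {vspace V}) (q : seq V).

Definition int_part U : set V := [set x | x \in U] `&` [set x | int_vec O x].

Definition pid_unit (x : F) : Prop := [/\ x != 0, O x & O x^-1].

Lemma pid_unitM x y : pid_unit x -> pid_unit y -> pid_unit (x * y).
Proof.
case: pidO => _ _ OM _ _ [x0 Ox Ox'] [y0 Oy Oy'].
by split; rewrite ?mulf_neq0 ?invfM //; apply: OM.
Qed.

Lemma pid_unitV x : pid_unit x -> pid_unit x^-1.
Proof. by case=> x0 Ox Ox'; split; rewrite ?invr_eq0 ?invrK. Qed.

Lemma pid_unit1 : pid_unit 1.
Proof. by case: pidO => ? _ _ _ _; split; rewrite ?invr1 ?oner_neq0. Qed.

Lemma saturated_module_basis W U : (W <= U)%VS ->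
  exists q, module_basis O (int_part U) (int_part W) q.
Proof.
move=> WU; have [q [bq iq cq]] := saturated_basis pidO WU.
have /andP[_] := bq; rewrite cat_free => /and3P[_ fq /directv_addP dWq].
rewrite (span_basis (vbasisP W)) in dWq.
exists q; split=> [x xq|v [vU iv]].
  split; last exact: iq.
  by apply: (basis_mem bq); rewrite mem_cat xq orbT.
have [c Oc vW] := cq v vU iv.
exists (fun i => c i); split.
  split=> //; split=> //; apply: (int_vecB pidO) => //.
  by apply: (int_vec_sum pidO) => i; apply: (int_vecZ pidO) => //;
    apply: iq; rewrite mem_nth.
move=> d [_ [vW' _]]; apply/funext => i.
have /freeP/(_ (fun i => c i - d i)) := (fq : free (in_tuple q)).
move=> H; apply/eqP; rewrite -subr_eq0; apply/eqP; apply: H => {i}.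
under eq_bigr do rewrite scalerBl.
rewrite sumrB; apply/eqP; rewrite -memv0 -dWq memv_cap; apply/andP; split.
  by have := memvB vW' vW; rewrite opprB addrC addrA subrK.
by apply: memvB; apply: memv_suml => i _; rewrite memvZ // memv_span // mem_nth.
Qed.

Lemma module_basis_basis W U q : (W <= U)%VS ->
  module_basis O (int_part U) (int_part W) q -> basis_of U (vbasis W ++ q).
Proof.
move=> WU [qU qE].
have indep (k : 'I_(size q) -> F) :
    \sum_i k i *: q`_i \in W -> forall i, k i = 0.
  move=> kW i; have [r [Or r0 rk]] := pid_denominator pidO (codom k).
  apply: (mulfI r0); rewrite mulr0.
  have [|c [_ cU]] := qE 0.
    by split; [exact: mem0v|move=> j; rewrite mxE; exact: (pid0 pidO)].
  have iz : int_vec O (0 : V) by move=> j; rewrite mxE; exact: (pid0 pidO).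
  have e0 : c = fun=> 0.
    apply: cU; split=> [_|]; first exact: (pid0 pidO).
    rewrite big1 => [|j _ /=]; last by rewrite scale0r.
    by rewrite subr0; split=> //=; exact: mem0v.
  suff e1 : c = fun i => - (r * k i).
    have /= := congr1 (@^~ i) (etrans (esym e0) e1).
    by move=> /esym/eqP; rewrite oppr_eq0 => /eqP.
  apply: cU; split=> [j|].
    by apply: (pidN pidO); apply: rk; apply: codom_f.
  have -> : 0 - \sum_i - (r * k i) *: q`_i = r *: \sum_i k i *: q`_i.
    rewrite sub0r -sumrN scaler_sumr; apply: eq_bigr => j _.
    by rewrite scaleNr opprK scalerA.
  split; first exact: memvZ.
  rewrite scaler_sumr; apply: (int_vec_sum pidO) => j; rewrite scalerA.
  apply: (int_vecZ pidO); first by apply: rk; apply: codom_f.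
  by case: (qU q`_j) => //; rewrite mem_nth.
have fq : free q.
  rewrite -[q]/(tval (in_tuple q)); apply/freeP => k k0; apply: indep.
  by rewrite [X in X \in W]k0 mem0v.
apply: basis_span_free.
  rewrite cat_free (basis_free (vbasisP W)) fq; apply/directv_addP.
  rewrite (span_basis (vbasisP W)); apply/eqP; rewrite -subv0.
  apply/subvP => x; rewrite memv_cap => /andP[xW].
  move=> /(coord_span (X := in_tuple q)) xE; rewrite memv0 xE big1 // => i _.
  rewrite (indep (fun i => coord (in_tuple q) i x)) ?scale0r //.
  by rewrite -[X in X \in W]xE.
rewrite span_cat (span_basis (vbasisP W)).
apply/eqP; rewrite eqEsubv subv_add WU /=; apply/andP; split.
  by apply/span_subvP => x /qU[].
apply/subvP => x xU; have [r [Or r0 rx]] := int_vec_denominator pidO x.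
have [|c [[_ [cW _]] _]] := qE (r *: x); first by split; rewrite //= memvZ.
rewrite -[x]scale1r -(mulVf r0) -scalerA memvZ //.
rewrite -(subrK (\sum_i c i *: q`_i) (r *: x)) memv_add //.
by apply: memv_suml => i _; rewrite memvZ // memv_span // mem_nth.
Qed.

Lemma module_basis_vol_int W U q q' : (W <= U)%VS ->
  module_basis O (int_part U) (int_part W) q ->
  module_basis O (int_part U) (int_part W) q' ->
  O (vol (vbasis W ++ q') (vbasis W ++ q)).
Proof.
move=> WU mq mq'; have bq := module_basis_basis WU mq.
have bq' := module_basis_basis WU mq'.
have sq : size q' = size q.
  apply/eqP; rewrite -(eqn_add2l (size (vbasis W))) -!size_cat.
  by rewrite (basis_size bq) (basis_size bq').
have /choice[D] : forall i : 'I_(size q), exists c : 'I_(size q) -> F,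
    (forall j, O (c j)) /\ q'`_i - \sum_j c j *: q`_j \in W.
  move=> i; case: mq mq' => _ qE [q'U _].
  have [|c [[Oc [cW _]] _]] := qE q'`_i; first by apply: q'U; rewrite mem_nth ?sq.
  by exists c.
move=> /all_and2[OD DW].
pose M : 'M[F]_(\dim W + size q) := block_mx 1%:M 0
  (\matrix_(i, j) coord (vbasis W) j (q'`_i - \sum_j D i j *: q`_j))
  (\matrix_(i, j) D i j).
suff -> : vol (vbasis W ++ q') (vbasis W ++ q) = \det M.
  by rewrite det_lblock det1 mul1r; apply: (pid_det pidO) => i j; rewrite mxE.
apply: vol_mat; rewrite ?size_cat ?size_tuple ?(basis_free bq) // => i.
rewrite big_split_ord /=; case: (splitP i) => i' ii'.
  have -> : i = lshift _ i' by apply: val_inj.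
  rewrite /= nth_cat size_tuple ltn_ord [X in _ + X]big1 ?addr0.
    rewrite (bigD1 i') //= block_mxEul mxE eqxx scale1r big1 ?addr0.
      by rewrite nth_cat size_tuple ltn_ord.
    by move=> j /negPf ji; rewrite block_mxEul mxE eq_sym ji scale0r.
  by move=> j _; rewrite block_mxEur mxE scale0r.
have -> : i = rshift _ i' by apply: val_inj.
rewrite /= nth_cat size_tuple ltnNge leq_addr /= addKn.
rewrite -[LHS](subrK (\sum_j D i' j *: q`_j)); congr (_ + _).
  rewrite {1}(coord_vbasis (DW i')); apply: eq_bigr => j _.
  by rewrite block_mxEdl mxE nth_cat size_tuple ltn_ord.
apply: eq_bigr => j _; rewrite block_mxEdr mxE nth_cat size_tuple.
by rewrite ltnNge leq_addr /= addKn.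
Qed.

Lemma module_basis_vol_unit W U q q' : (W <= U)%VS ->
  module_basis O (int_part U) (int_part W) q ->
  module_basis O (int_part U) (int_part W) q' ->
  pid_unit (vol (vbasis W ++ q') (vbasis W ++ q)).
Proof.
move=> WU mq mq'; have bq := module_basis_basis WU mq.
have bq' := module_basis_basis WU mq'.
split; first exact: (vol_neq0 bq' bq).
  exact: (module_basis_vol_int WU).
by rewrite -(vol_inv bq bq'); exact: (module_basis_vol_int WU).
Qed.

Lemma vbasis0 : vbasis (0%VS : {vspace V}) = [::] :> seq V.
Proof. by apply: size0nil; rewrite size_tuple dimv0. Qed.

Lemma int_part0 : int_part 0 = [set 0].
Proof.
apply/seteqP; split=> [x [/=]|_ -> /=]; first by rewrite memv0 => /eqP.
by split; [exact: mem0v|move=> j; rewrite mxE; exact: (pid0 pidO)].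
Qed.

Definition is_car_for (A B : {vspace V}) (phi : homdet F n) : Prop :=
  is_homdet (A :&: B) (A + B) phi /\
  exists s q, [/\ module_basis O (int_part (A :&: B)) [set 0] s,
    module_basis O (int_part fullv) (int_part (A + B)) q & pid_unit (phi s q)].

Lemma car_for_exists A B : exists phi, is_car_for A B phi.
Proof.
have [s ms] := saturated_module_basis (sub0v (A :&: B)).
have [q mq] := saturated_module_basis (subvf (A + B)).
have bs := module_basis_basis (sub0v _) ms; rewrite vbasis0 /= in bs.
have bq := module_basis_basis (subvf _) mq.
rewrite int_part0 in ms.
have [phi hphi phi1] := homdet_exists 1 bs bq.
exists phi; split=> //; exists s, q; split=> //; rewrite phi1.
exact: pid_unit1.
Qed.

Lemma car_for_basis A B phi : is_car_for A B phi -> exists s q,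
  [/\ basis_of (A :&: B) s, quotient_basis (A + B) q & pid_unit (phi s q)].
Proof.
case=> _ [s [q [ms mq u]]]; exists s, q; split=> //.
  rewrite -int_part0 in ms.
  by have := module_basis_basis (sub0v _) ms; rewrite vbasis0.
exact: module_basis_basis (subvf _) mq.
Qed.

Lemma car_for_neq0 A B phi s q : is_car_for A B phi -> basis_of (A :&: B) s ->
  quotient_basis (A + B) q -> phi s q != 0.
Proof.
move=> hphi bs bq; have [s' [q' [bs' bq' [u0 _ _]]]] := car_for_basis hphi.
by case: hphi => h _; exact: homdet_neq0 h bs' bs bq' bq u0.
Qed.

Lemma car_for_unit A B phi phi' s0 q0 : is_car_for A B phi ->
  is_car_for A B phi' -> basis_of (A :&: B) s0 -> quotient_basis (A + B) q0 ->
  pid_unit (phi' s0 q0 / phi s0 q0).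
Proof.
move=> c c' bs0 bq0; have phi0 := car_for_neq0 c bs0 bq0.
case: c c' => h [s [q [ms mq u]]] [h' [s' [q' [ms' mq' u']]]].
rewrite -int_part0 in ms ms'.
have bs := module_basis_basis (sub0v _) ms; rewrite vbasis0 /= in bs.
have bs' := module_basis_basis (sub0v _) ms'; rewrite vbasis0 /= in bs'.
have bq := module_basis_basis (subvf _) mq.
have bq' := module_basis_basis (subvf _) mq'.
have us := module_basis_vol_unit (sub0v _) ms' ms; rewrite vbasis0 /= in us.
have uq := module_basis_vol_unit (subvf _) mq' mq.
suff -> : phi' s0 q0 / phi s0 q0 =
    vol s s' * phi' s' q' / (vol (vbasis (A + B) ++ q) (vbasis (A + B) ++ q') *
      phi s q).
  by apply: pid_unitM; [|apply: pid_unitV]; apply: pid_unitM.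
have e := h s s0 q q0 bs bs0 bq bq0.
have e' := h' s' s0 q' q0 bs' bs0 bq' bq0.
rewrite (vol_trans bs0 bs bs') (vol_trans bq0 bq bq') in e'.
have us0 := vol_neq0 bs0 bs; have uq0 := vol_neq0 bq0 bq.
case: us uq u => us _ _ [uq _ _] [u _ _].
apply/eqP; rewrite eqr_div ?mulf_neq0 //; apply/eqP.
apply: (mulfI us0); apply: (mulfI uq0).
transitivity (phi' s0 q0 * (vol (vbasis (A + B) ++ q0) (vbasis (A + B) ++ q) *
   vol (vbasis (A + B) ++ q) (vbasis (A + B) ++ q')) * (vol s0 s * phi s q)).
  by ring.
by rewrite e' -e; ring.
Qed.

Lemma car_forZ A B phi e : is_car_for A B phi -> pid_unit e ->
  is_car_for A B (fun s q => e * phi s q).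
Proof.
case=> h [s [q [ms mq u]]] ue; split; last first.
  by exists s, q; split=> //; apply: pid_unitM.
move=> s1 s2 q1 q2 b1 b2 b3 b4.
by rewrite -mulrA (h s1 s2 q1 q2) // mulrCA.
Qed.

(* Passing to the saturation of the sum costs nothing: a common denominator
   clears the components of an integral vector of A + B. *)
Lemma saturation_int_part A B :
  [set x | int_vec O x] `&` [set x | exists r, [/\ O r, r != 0 &
    [set x + y | x in int_part A & y in int_part B] (r *: x)]] =
  int_part (A + B).
Proof.
apply/seteqP; split=> [x [/= ix [r [Or r0 [a [aA _] [b [bB _] e]]]]]|].
  split=> //=; rewrite -[x]scale1r -(mulVf r0) -scalerA memvZ // -e.
  exact: memv_add.
move=> x [/= /memv_addP[a aA [b bB ->]] ix]; split=> //=.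
have [r [Or r0 ra]] := int_vec_denominator pidO a.
have [t [Ot t0 tb]] := int_vec_denominator pidO b.
case: (pidO) => _ _ OM _ _.
exists (r * t); split; [exact: OM|exact: mulf_neq0|].
exists ((r * t) *: a).
  split; rewrite /= ?memvZ // mulrC -scalerA.
  exact: (int_vecZ pidO).
exists ((r * t) *: b); last by rewrite scalerDr.
split; rewrite /= ?memvZ // -scalerA; exact: (int_vecZ pidO).
Qed.

End ModuleBases.

(** * Integers of a number field *)

Lemma double_ratio_change (F : fieldType)
    (c00 c01 c11 c10 d00 d01 d11 d10 t00 t01 t11 t10 : F) :
  d00 != 0 -> d01 != 0 -> d11 != 0 -> d10 != 0 ->
  t00 != 0 -> t01 != 0 -> t11 != 0 -> t10 != 0 ->
  (c00 * t00) / (c01 * t01) * ((c11 * t11) / (c10 * t10)) =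
  (d00 * t00) / (d01 * t01) * ((d11 * t11) / (d10 * t10)) *
  ((c00 / d00 * (c11 / d11)) / (c01 / d01 * (c10 / d10))).
Proof.
move=> *; rewrite !(invfM, invrK).
set x := c01^-1; set y := c10^-1.
by field; do ![apply/andP; split].
Qed.

Section NumberFieldIntegers.
Variable kappa : fieldExtType rat.
Local Notation O := (@ring_of_integers kappa).

Lemma intr_alg_eq0 (z : int) : (z%:~R == 0 :> kappa) = (z == 0).
Proof. by rewrite -(rmorph_int (in_alg kappa)) fmorph_eq0 intr_eq0. Qed.

Lemma integral_denominator (x : kappa) : exists r, [/\ O r, r != 0 & O (r * x)].
Proof.
have [q q0 qx] : exists2 q : {poly int}, q != 0 & root (map_poly intr q) x.
  have /polyOver1P[p pE] := minPolyOver 1 x.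
  have [q [a a0 pq]] := rat_poly_scale p.
  have p0 : p != 0.
    apply: contraTneq (monic_minPoly 1 x) => p0.
    by rewrite pE p0 map_poly0 monicE lead_coef0 eq_sym oner_eq0.
  exists q; first by apply: contraNneq p0 => q0; rewrite pq q0 map_poly0 scaler0.
  have := root_minPoly 1 x; rewrite pE pq map_polyZ /= -map_poly_comp /=.
  rewrite /root hornerZ mulf_eq0 scaler_eq0 oner_eq0 orbF invr_eq0 intr_eq0.
  rewrite (negPf a0) /=.
  congr (_ == 0); congr (_.[_]); apply: eq_map_poly => z /=.
  exact: (rmorph_int (in_alg kappa)).
pose d := (size q).-1; pose c := lead_coef q.
have c0 : c != 0 by rewrite lead_coef_eq0.
have ck0 : c%:~R != 0 :> kappa.
  by rewrite intr_alg_eq0.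
have sq : size q = d.+1 by rewrite /d prednK // lt0n size_poly_eq0.
exists c%:~R; split=> //; first exact: integral_id.
pose P : {poly int} := \poly_(i < d.+1) (if i == d then 1 else q`_i * c ^+ (d.-1 - i)).
have sP : size P = d.+1.
  by rewrite size_poly_eq ?eqxx ?oner_neq0.
exists P; first by rewrite monicE lead_coefE sP coef_poly ltnSn eqxx.
have d0 : (0 < d)%N.
  rewrite lt0n; apply: contraTneq qx => d0.
  have /size_poly1P[a a0 ->] : size q == 1%N by rewrite sq d0.
  by rewrite map_polyC rootC /= intr_alg_eq0.
rewrite /root horner_coef size_map_poly_id0; last first.
  by rewrite lead_coefE sP coef_poly ltnSn eqxx rmorph1 oner_neq0.
rewrite sP; have : (map_poly intr q).[x] * (c%:~R ^+ d.-1) == 0.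
  by rewrite (rootP qx) mul0r.
rewrite horner_coef size_map_poly_id0 ?sq // mulr_suml.
congr (_ == 0); apply: eq_bigr => i _; rewrite !coef_map coef_poly ltn_ord.
case: eqP => [->|/eqP id].
  rewrite /= -[q`_d]/(q`_(size q).-1) -lead_coefE -/c exprMn mulr1z mul1r.
  by rewrite mulrAC -exprS prednK.
rewrite /= intrM rmorphXn /= exprMn -!mulrA; congr (_ * _).
rewrite mulrA -exprD mulrC subnK //.
have := ltn_ord i; rewrite ltnS leq_eqVlt (negPf id) /=.
by rewrite -(@ltnS i) prednK.
Qed.

Lemma integers_pid : class_number_one kappa -> pid_in O.
Proof.
have O1 : O 1 by exact: integral1.
move=> cl; split=> //.
- by move=> x y; exact: integral_sub.
- by move=> x y; exact: integral_mul.
- exact: integral_denominator.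
move=> I IO I0 ID IM.
have idO : nonzero_ideal O.
  split=> //; first by exists 1; rewrite ?oner_neq0.
    by move=> x y; exact: integral_add.
  by move=> x y; exact: integral_mul.
have [a [b [Oa Ob a0 b0 e]]] := cl I O (And4 IO I0 ID IM) idO.
have : [set b * y | y in O] b by exists 1; rewrite ?mulr1.
rewrite -e => -[d Id bE]; exists d => // y Iy.
have : [set a * x | x in I] (a * y) by exists y.
rewrite e => -[c Oc] /= yE; exists c => //; apply: (mulfI a0).
by rewrite -yE -bE mulrCA mulrA mulrC mulrA.
Qed.

Section ArithmeticCrossRatio.
Variable n : nat.
Local Notation V := 'rV[kappa]_n.+1.
Hypothesis pidO : pid_in O.

Lemma is_carE (A B : {vspace V}) phi : is_car A B phi <-> is_car_for O A B phi.
Proof.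
have sat : saturation [set x + y | x in integral_part A & y in integral_part B]
    = int_part O (A + B) by exact: (saturation_int_part pidO).
have std : @std_lattice kappa n = int_part O fullv.
  apply/seteqP; split=> [x ix|x [_ ix]] //.
  by split=> //=; exact: memvf.
by rewrite /is_car sat std.
Qed.

Variables A B : 'I_2 -> {vspace V}.

Lemma arithmetic_cross_ratio_nonempty : arithmetic_cross_ratio A B !=set0.
Proof.
have H i : forall j, exists phi, is_car_for O (A i) (B j) phi.
  by move=> j; exact: car_for_exists.
have /choice[c cE] : forall i, exists f : 'I_2 -> homdet kappa n,
    forall j, is_car_for O (A i) (B j) (f j).
  by move=> i; have [f fE] := choice (H i); exists f.
by exists (degenerate_cross_ratio A B c), c => // i j; apply/is_carE.
Qed.

Lemma degenerate_cross_ratioE c d :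
  (forall i j, is_car (A i) (B j) (d i j)) ->
  degenerate_cross_ratio A B c =
    degenerate_cross_ratio A B d * tensor_ratio A B c d.
Proof.
move=> hd; rewrite /degenerate_cross_ratio /tensor_ratio.
set vA := fun i => vbasis (A i); set vB := fun i => vbasis (B i).
pose s i j := vbasis (A i :&: B j); pose q i j := vbasis (A i + B j)^C.
have sE f i j : star (A i) (B j) (vbasis (A i)) (vbasis (B j)) (f i j) =
    f i j (s i j) (q i j) *
    star (A i) (B j) (vbasis (A i)) (vbasis (B j)) (fun _ _ => 1).
  exact: starE.
rewrite !sE -/(s _ _) -/(q _ _).
have d0 i j : d i j (s i j) (q i j) != 0.
  have /is_carE h := hd i j.
  by apply: (car_for_neq0 pidO h); [exact: vbasisP|exact/quotient_basis_compl/vbasisP].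
have t0 i j := star1_neq0 (vbasisP (A i)) (vbasisP (B j)).
exact: double_ratio_change.
Qed.

Lemma tensor_ratio_car c d :
  (forall i j, is_car (A i) (B j) (c i j)) ->
  (forall i j, is_car (A i) (B j) (d i j)) ->
  integer_units (tensor_ratio A B d c).
Proof.
move=> hc hd.
have u i j : pid_unit O (d i j (vbasis (A i :&: B j)) (vbasis (A i + B j)^C) /
    c i j (vbasis (A i :&: B j)) (vbasis (A i + B j)^C)).
  have /is_carE h := hc i j; have /is_carE h' := hd i j.
  apply: (car_for_unit pidO h h'); first exact: vbasisP.
  exact/quotient_basis_compl/vbasisP.
rewrite /tensor_ratio /=; apply: (pid_unitM pidO).
  exact: (pid_unitM pidO).
by apply: pid_unitV; exact: (pid_unitM pidO).
Qed.

Lemma degenerate_cross_ratioZ c e : integer_units e ->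
  (forall i j, is_car (A i) (B j) (c i j)) ->
  exists2 c', forall i j, is_car (A i) (B j) (c' i j) &
    degenerate_cross_ratio A B c' = e * degenerate_cross_ratio A B c.
Proof.
move=> ue hc.
pose c' (i j : 'I_2) : homdet kappa n :=
  if (i == 0) && (j == 0) then (fun s q => e * c i j s q) else c i j.
have e0 : e != 0 by case: ue.
exists c' => [i j|].
  rewrite /c'; case: ifP => // _; apply/is_carE; apply: (car_forZ pidO _ ue).
  exact/is_carE.
rewrite (degenerate_cross_ratioE c' hc) mulrC; congr (_ * _).
have c0 i j : c i j (vbasis (A i :&: B j)) (vbasis (A i + B j)^C) != 0.
  have /is_carE h := hc i j.
  by apply: (car_for_neq0 pidO h); [exact: vbasisP|exact/quotient_basis_compl/vbasisP].
by rewrite /tensor_ratio /c' /= mulfK // !divff // ?mulr1 ?divr1.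
Qed.

End ArithmeticCrossRatio.

Section LimitComparison.
Variables (n k : nat) (A B : 'I_2 -> {vspace 'rV[laurent kappa]_n.+1}).
Hypothesis pidO : pid_in O.
Hypothesis cAB : complementary k A B.
Variables a b : 'I_2 -> seq 'rV[fps kappa]_n.+1.
Hypothesis ba : forall i, basis_of (A i) (map (@toK _ _) (a i)).
Hypothesis bb : forall i, basis_of (B i) (map (@toK _ _) (b i)).
Let As i := special_fibre (A i).
Let Bs i := special_fibre (B i).

Lemma clim_over_car_nonempty : clim_over_car A B !=set0.
Proof.
have [_ [c hc _]] := arithmetic_cross_ratio_nonempty pidO As Bs.
have /choice[clim climE] : forall i, exists f : 'I_2 -> homdet kappa n,
    forall j, is_clim (A i) (B j) (f j).
  by move=> i; have [f fE] := choice (clim_exists cAB i); exists f.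
by exists (tensor_ratio As Bs clim c), clim, c.
Qed.

Lemma arithmetic_limit_product x y :
  arithmetic_cross_ratio As Bs x -> clim_over_car A B y ->
  exists2 e, integer_units e & x * y = limit_ratio a b * e.
Proof.
move=> [c hc ->] [clim [car [hclim hcar ->]]].
rewrite -(degenerate_cross_ratio_clim cAB hclim ba bb).
have u := tensor_ratio_car pidO hc hcar.
exists (tensor_ratio As Bs car c)^-1.
  exact: pid_unitV.
rewrite (degenerate_cross_ratioE pidO clim hcar).
rewrite (degenerate_cross_ratioE pidO car hc).
set t := tensor_ratio _ _ car c in u *.
have t0 : t != 0 by case: u.
by rewrite [RHS]mulrAC mulrK // unitfE.
Qed.

Lemma arithmetic_limit_product_unit e : integer_units e ->
  exists x y, [/\ arithmetic_cross_ratio As Bs x, clim_over_car A B y &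
    x * y = limit_ratio a b * e].
Proof.
move=> ue; have [x Ax] := arithmetic_cross_ratio_nonempty pidO As Bs.
have [y Cy] := clim_over_car_nonempty.
have [e' ue' xy] := arithmetic_limit_product Ax Cy.
case: Ax => c hc xE.
have [|c' hc' E] := degenerate_cross_ratioZ (e := e / e') pidO _ hc.
  by apply: (pid_unitM pidO) => //; exact: pid_unitV.
exists (e / e' * x), y; split=> //; first by exists c'; rewrite // E xE.
have e'0 : e' != 0 by case: ue'.
by rewrite -mulrA xy mulrCA mulfVK.
Qed.

End LimitComparison.
End NumberFieldIntegers.

(** * Embeddings and the norm *)

Section Embeddings.
Variables (kappa : fieldExtType rat) (C : numClosedFieldType).
Local Notation toC := (map_poly (ratr : rat -> C)).
Local Notation d := (\dim {:kappa}).
Local Notation basis := (vbasis {:kappa}).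

Definition mul_matrix (x : kappa) : 'M[rat]_d :=
  \matrix_(i, j) coord basis j (x * basis`_i).

Lemma primitive_element : exists alpha : kappa,
  (<<1; alpha>> = {:kappa})%VS /\ separable_poly (minPoly 1 alpha).
Proof.
have c0 : [pchar kappa] =i pred0 by move=> p; rewrite pchar_lalg pchar_num.
exists (separable_generator 1 {:kappa}); split; last first.
  exact: (separable_generatorP).
apply/esym; apply: eq_adjoin_separable_generator; last exact: subvf.
by apply/separableP => y _; apply: pcharf0_separable.
Qed.

Lemma coord_embedding (tau : {rmorphism kappa -> C}) x :
  tau x = \sum_(i < d) ratr (coord basis i x) * tau basis`_i.
Proof.
rewrite {1}(coord_vbasis (memvf x)) rmorph_sum; apply: eq_bigr => i _.
rewrite -mulr_algl rmorphM; congr (_ * _).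
exact: (fmorph_eq_rat (tau \o in_alg kappa)).
Qed.

Lemma embedding_family : exists T : 'I_d -> {rmorphism kappa -> C},
  [/\ forall i j, T i =1 T j -> i = j,
      forall tau : {rmorphism kappa -> C}, exists i, tau =1 T i &
      forall x, \prod_i T i x = ratr (\det (mul_matrix x))].
Proof.
have [alpha [gen sep]] := primitive_element.
have /polyOver1P[p pE] := minPolyOver 1 alpha.
have dE : size p = d.+1.
  rewrite -(size_map_poly (in_alg kappa)) -pE size_minPoly adjoin_degreeE gen.
  by rewrite dimv1 divn1.
have sepC : separable_poly (toC p).
  by rewrite separable_map -(separable_map (in_alg kappa)) -pE.
have [r rE] := closed_field_poly_normal (toC p).
have monC : lead_coef (toC p) = 1.
  apply/eqP; rewrite -monicE map_monic -(map_monic (in_alg kappa)) -pE.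
  exact: monic_minPoly.
rewrite monC scale1r in rE.
have ur : uniq r by rewrite -separable_prod_XsubC -rE.
have sr : size r = d.
  by apply/eqP; rewrite -eqSS -(@size_prod_XsubC _ _ r id) -rE size_map_poly dE.
have /choice[g gE] : forall x, exists q : {poly rat},
    (map_poly (in_alg kappa) q).[alpha] = x.
  move=> x; have : x \in <<1; alpha>>%VS by rewrite gen memvf.
  by case/Fadjoin_polyP => q /polyOver1P[q' ->] ->; exists q'.
have wd z q q' : z \in r ->
    (map_poly (in_alg kappa) q).[alpha] = (map_poly (in_alg kappa) q').[alpha] ->
    (toC q).[z] = (toC q').[z].
  move=> zr e; have : root (map_poly (in_alg kappa) (q - q')) alpha.
    by rewrite /root rmorphB hornerD hornerN e subrr.
  move=> rt; have : minPoly 1 alpha %| map_poly (in_alg kappa) (q - q').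
    by apply: minPoly_dvdp => //; apply/polyOver1P; exists (q - q').
  rewrite pE dvdp_map => /dvdpP[s sE].
  have pz : (toC p).[z] = 0.
    by apply/eqP; rewrite rE -/(root _ _) root_prod_XsubC.
  apply/eqP; rewrite -subr_eq0 -hornerN -hornerD -rmorphB sE rmorphM hornerM.
  by rewrite /= pz mulr0.
pose z (i : 'I_d) := r`_i.
have zr i : z i \in r by rewrite mem_nth // sr.
pose tau i x := (toC (g x)).[z i].
have tauZ i : zmod_morphism (tau i).
  move=> x y; rewrite /tau -hornerN -hornerD -rmorphB; apply: wd => //.
  by rewrite rmorphB hornerD hornerN !gE.
have tauM i : monoid_morphism (tau i).
  split=> [|x y]; rewrite /tau.
    transitivity (toC 1).[z i]; last by rewrite rmorph1 hornerC.
    by apply: wd; rewrite // rmorph1 gE hornerC.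
  rewrite -hornerM -rmorphM; apply: wd => //.
  by rewrite rmorphM hornerM !gE.
pose T i : {rmorphism kappa -> C} := HB.pack (tau i)
  (GRing.isZmodMorphism.Build _ _ (tau i) (tauZ i))
  (GRing.isMonoidMorphism.Build _ _ (tau i) (tauM i)).
have Talpha i : T i alpha = z i.
  transitivity (toC 'X).[z i]; last by rewrite map_polyX hornerX.
  by apply: wd; rewrite // gE map_polyX hornerX.
exists T; split.
- move=> i j /(_ alpha); rewrite !Talpha /z => /eqP.
  by rewrite nth_uniq ?sr // => /eqP/val_inj.
- move=> f; have fz q : f (map_poly (in_alg kappa) q).[alpha] = (toC q).[f alpha].
    rewrite -horner_map -map_poly_comp; congr (_.[_]); apply: eq_map_poly => a.
    exact: (fmorph_eq_rat (f \o in_alg kappa)).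
  have : root (toC p) (f alpha) by rewrite /root -fz -pE minPolyxx rmorph0.
  rewrite rE root_prod_XsubC => fr.
  have ir : (index (f alpha) r < d)%N by rewrite -sr index_mem.
  exists (Ordinal ir) => x; rewrite -{1}(gE x) fz.
  by rewrite -[RHS]/((toC (g x)).[z (Ordinal ir)]) /z /= nth_index.
move=> x; pose E := \matrix_(i < d, j < d) T j basis`_i.
pose D := diag_mx (\row_(j < d) T j x).
have ME : map_mx ratr (mul_matrix x) *m E = E *m D.
  apply/matrixP => i j; rewrite mul_mx_diag !mxE mulrC -rmorphM.
  rewrite [RHS]coord_embedding; apply: eq_bigr => k _.
  by rewrite !mxE.
pose P := \matrix_(i < d, k < d) ratr (coord basis k (alpha ^+ i)) : 'M[C]_d.
have PE : Vandermonde d (\row_j z j) = P *m E.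
  apply/matrixP => i j; rewrite !mxE -Talpha -rmorphXn [LHS]coord_embedding.
  by apply: eq_bigr => k _; rewrite !mxE.
have E0 : \det E != 0.
  have : \det (Vandermonde d (\row_j z j)) != 0.
    rewrite det_Vandermonde; apply/prodf_neq0 => i _; apply/prodf_neq0 => j ij.
    rewrite !mxE subr_eq0 /z nth_uniq ?sr //.
    by rewrite eq_sym; apply: contraTneq ij => ->; rewrite ltnn.
  by rewrite PE det_mulmx mulf_eq0 negb_or => /andP[].
move/(congr1 determinant): ME; rewrite !det_mulmx mulrC => /(mulfI E0).
rewrite det_map_mx det_diag => ->; apply: eq_bigr => j _; by rewrite mxE.
Qed.

End Embeddings.

Section AbsNorm.
Variable kappa : fieldExtType rat.
Implicit Types x y : kappa.

Lemma abs_normE x : abs_norm x = `|\det (mul_matrix x)|.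
Proof. by []. Qed.

Lemma abs_normM x y : abs_norm (x * y) = abs_norm x * abs_norm y.
Proof.
have [T [_ _ TE]] := embedding_family kappa algC.
have e : ratr (\det (mul_matrix (x * y))) =
    ratr (\det (mul_matrix x) * \det (mul_matrix y)) :> algC.
  rewrite [RHS]rmorphM /= -!TE -big_split /=; apply: eq_bigr => i _.
  exact: rmorphM.
by rewrite !abs_normE -normrM; congr `|_|; apply: fmorph_inj e.
Qed.

Lemma abs_norm_gt0 x : x != 0 -> 0 < abs_norm x.
Proof.
have [T [_ _ TE]] := embedding_family kappa algC.
move=> x0; rewrite abs_normE normr_gt0; have /prodf_neq0 : forall i, true -> T i x != 0.
  by move=> i _; rewrite fmorph_eq0.
by rewrite TE fmorph_eq0.
Qed.

Lemma abs_norm_ge1 x : ring_of_integers x -> x != 0 -> 1 <= abs_norm x.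
Proof.
have [T [_ _ TE]] := embedding_family kappa algC.
move=> [p mp px] x0; have : ratr (\det (mul_matrix x)) \in (Num.int : {pred algC}).
  apply: Cint_rat_Aint; first exact: Crat_rat.
  rewrite -TE; apply: rpred_prod => i _.
  apply: (@root_monic_Aint (map_poly intr p)).
  - have : root (map_poly (T i) (map_poly intr p)) (T i x) by rewrite fmorph_root.
    congr (is_true (root _ _)); rewrite -map_poly_comp.
    by apply: eq_map_poly => z; exact: rmorph_int.
  - exact: monic_map.
  - by apply/polyOverP => j; rewrite coef_map /=.
move=> /intrP[m mE].
have detE : \det (mul_matrix x) = m%:~R.
  apply: (fmorph_inj (ratr : {rmorphism rat -> algC})).
  by rewrite /= mE ratr_int.
rewrite abs_normE; apply: norm_intr_ge1; first by rewrite detE.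
by have := abs_norm_gt0 x0; rewrite abs_normE normr_gt0.
Qed.

Lemma abs_norm_unit x : integer_units x -> abs_norm x = 1.
Proof.
move=> [x0 Ox Ox']; have x0' : x^-1 != 0 by rewrite invr_eq0.
have N1 : abs_norm (1 : kappa) = 1.
  have : abs_norm (1 : kappa) * abs_norm (1 : kappa) = abs_norm (1 : kappa).
    by rewrite -abs_normM mulr1.
  move/(canRL (mulfK _)); rewrite divff ?gt_eqF ?abs_norm_gt0 ?oner_neq0 //.
  by apply.
have := abs_norm_ge1 Ox' x0'; have := abs_norm_ge1 Ox x0 => x1 x1'.
apply/eqP; rewrite eq_le x1 andbT -N1 -(divff x0) abs_normM.
by rewrite ler_peMr // (le_trans ler01).
Qed.

End AbsNorm.

(** * Asymptotic expansions at a puncture *)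

Section GermExpansion.
Variables (F : fieldType) (K : numFieldType) (tau : {rmorphism F -> K}).
Implicit Types (f g : fps F) (G H : K -> K).

Local Notation near0 P := (\forall z \near (0 : K^o)^', P z).

Definition bounded_germ H : Prop := exists M : K, near0 (fun z => `|H z| <= M).

Lemma bounded_germ_cst c : bounded_germ (fun=> c).
Proof. by exists `|c|; near=> z. Unshelve. all: by end_near. Qed.

Lemma bounded_germD G H : bounded_germ G -> bounded_germ H ->
  bounded_germ (fun z => G z + H z).
Proof.
move=> [M GM] [N HN]; exists (M + N); near=> z.
rewrite (le_trans (ler_normD _ _)) // lerD //; near: z.
- exact: GM.
- exact: HN.
Unshelve. all: by end_near. Qed.

Lemma bounded_germM G H : bounded_germ G -> bounded_germ H ->
  bounded_germ (fun z => G z * H z).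
Proof.
move=> [M GM] [N HN]; exists (M * N); near=> z.
rewrite normrM ler_pM //; near: z.
- exact: GM.
- exact: HN.
Unshelve. all: by end_near. Qed.

Lemma bounded_germ_id : bounded_germ id.
Proof. by exists 1; apply: dnbhs0_le. Qed.

Lemma bounded_germ_exp m : bounded_germ (fun z => z ^+ m).
Proof.
elim: m => [|m IH]; first exact: bounded_germ_cst.
under [X in bounded_germ X]eq_fun do rewrite exprS.
exact: (bounded_germM bounded_germ_id IH).
Qed.

Lemma bounded_germ_poly (p : {poly K}) : bounded_germ (fun z => p.[z]).
Proof.
elim/poly_ind: p => [|p c IH].
  under [X in bounded_germ X]eq_fun do rewrite horner0.
  exact: bounded_germ_cst.
under [X in bounded_germ X]eq_fun do rewrite hornerMXaddC.
exact: (bounded_germD (bounded_germM IH bounded_germ_id) (bounded_germ_cst c)).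
Qed.

Definition fps_trunc N f : {poly K} := \poly_(i < N) tau (fps_coef f i).

(* G has the asymptotic expansion f at 0, to every order; no convergence of f is
   involved, which makes the relation trivially compatible with products. *)
Definition expands G f : Prop := forall N, exists2 H, bounded_germ H &
  near0 (fun z => G z = (fps_trunc N f).[z] + z ^+ N * H z).

Lemma fps_truncD N f g : fps_trunc N (f + g) = fps_trunc N f + fps_trunc N g.
Proof.
apply/polyP => i; rewrite coefD !coef_poly; case: ifP => _; last by rewrite addr0.
by rewrite fps_coefD rmorphD.
Qed.

Lemma fps_truncN N f : fps_trunc N (- f) = - fps_trunc N f.
Proof.
apply/polyP => i; rewrite coefN !coef_poly; case: ifP => _; last by rewrite oppr0.
exact: rmorphN.
Qed.

Lemma fps_truncM N f g : fps_trunc N f * fps_trunc N g =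
  fps_trunc N (f * g) + drop_poly N (fps_trunc N f * fps_trunc N g) * 'X^N.
Proof.
rewrite -{1}(poly_take_drop N (fps_trunc N f * fps_trunc N g)); congr (_ + _).
apply/polyP => i; rewrite coef_take_poly coef_poly; case: ltnP => // iN.
rewrite fps_coefM rmorph_sum coefM; apply: eq_bigr => -[j /=]; rewrite ltnS => ji _.
by rewrite !coef_poly (leq_ltn_trans ji) // (leq_ltn_trans (leq_subr _ _)) // rmorphM.
Qed.

Lemma expandsD G H f g : expands G f -> expands H g ->
  expands (fun z => G z + H z) (f + g).
Proof.
move=> Gf Hg N; have [G' bG' GE] := Gf N; have [H' bH' HE] := Hg N.
exists (fun z => G' z + H' z); first exact: bounded_germD.
near=> z; rewrite fps_truncD hornerD mulrDr addrACA; congr (_ + _); near: z.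
- exact: GE.
- exact: HE.
Unshelve. all: by end_near. Qed.

Lemma expandsN G f : expands G f -> expands (fun z => - G z) (- f).
Proof.
move=> Gf N; have [G' [M GM] GE] := Gf N.
exists (fun z => - G' z); first by exists M; under eq_near do rewrite normrN.
near=> z; rewrite fps_truncN hornerN mulrN -opprD; congr (- _); near: z.
exact: GE.
Unshelve. all: by end_near. Qed.

Lemma expandsM G H f g : expands G f -> expands H g ->
  expands (fun z => G z * H z) (f * g).
Proof.
move=> Gf Hg N; have [G' bG' GE] := Gf N; have [H' bH' HE] := Hg N.
pose p := fps_trunc N f; pose q := fps_trunc N g.
pose Q z := (drop_poly N (p * q)).[z] +
  (p.[z] * H' z + (q.[z] * G' z + z ^+ N * (G' z * H' z))).
exists Q.
  apply: bounded_germD; first exact: bounded_germ_poly.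
  apply: bounded_germD; first exact: bounded_germM (bounded_germ_poly _) bH'.
  apply: bounded_germD; first exact: bounded_germM (bounded_germ_poly _) bG'.
  exact: bounded_germM (bounded_germ_exp _) (bounded_germM bG' bH').
near=> z.
have -> : G z = p.[z] + z ^+ N * G' z by near: z; exact: GE.
have -> : H z = q.[z] + z ^+ N * H' z by near: z; exact: HE.
have : (p * q).[z] = p.[z] * q.[z] by rewrite hornerM.
rewrite {1}/p {1}/q fps_truncM -/p -/q hornerD hornerM hornerXn.
move/(canRL (addrK _)) => ->; rewrite /Q; ring.
Unshelve. all: by end_near. Qed.

Lemma expands0 : expands (fun=> 0) 0.
Proof.
move=> N; exists (fun=> 0); first exact: bounded_germ_cst.
near=> z; rewrite mulr0 addr0 [X in X.[_]](_ : _ = 0) ?horner0 //.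
apply/polyP => i; rewrite coef_poly coef0; case: ifP => // _.
by rewrite fps_coef_0 rmorph0.
Unshelve. all: by end_near. Qed.

Lemma expands1 : expands (fun=> 1) 1.
Proof.
case=> [|N].
  exists (fun=> 1); first exact: bounded_germ_cst.
  near=> z; rewrite mulr1 [X in X.[_]](_ : _ = 0) ?horner0 ?add0r //.
  by apply/polyP => i; rewrite coef_poly coef0.
exists (fun=> 0); first exact: bounded_germ_cst.
near=> z; rewrite mulr0 addr0 [X in X.[_]](_ : _ = 1) ?hornerC //.
apply/polyP => i; rewrite coef_poly coef1 fps_coef_1.
by case: i => [|i] /=; rewrite ?rmorph1 // rmorph0 if_same.
Unshelve. all: by end_near. Qed.

Lemma expands_sum (I : Type) (r : seq I) (P : pred I) (G : I -> K -> K)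
    (f : I -> fps F) : (forall i, expands (G i) (f i)) ->
  expands (fun z => \sum_(i <- r | P i) G i z) (\sum_(i <- r | P i) f i).
Proof.
move=> Gf; elim: r => [|i r IH].
  under [X in expands X]eq_fun do rewrite big_nil; rewrite big_nil.
  exact: expands0.
under [X in expands X]eq_fun do rewrite big_cons; rewrite big_cons.
by case: (P i) => //; apply: expandsD.
Qed.

Lemma expands_prod (I : Type) (r : seq I) (P : pred I) (G : I -> K -> K)
    (f : I -> fps F) : (forall i, expands (G i) (f i)) ->
  expands (fun z => \prod_(i <- r | P i) G i z) (\prod_(i <- r | P i) f i).
Proof.
move=> Gf; elim: r => [|i r IH].
  under [X in expands X]eq_fun do rewrite big_nil; rewrite big_nil.
  exact: expands1.
under [X in expands X]eq_fun do rewrite big_cons; rewrite big_cons.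
by case: (P i) => //; apply: expandsM.
Qed.

Lemma expands_det m (G : K -> 'M[K]_m) (f : 'M[fps F]_m) :
  (forall i j, expands (fun z => G z i j) (f i j)) ->
  expands (fun z => \det (G z)) (\det f).
Proof.
have sgn (b : bool) : expands (fun=> (-1) ^+ b) ((-1) ^+ b).
  by case: b; [apply: (expandsN expands1)|exact: expands1].
move=> Gf; apply: expands_sum => s; apply: expandsM; first exact: sgn.
by apply: expands_prod.
Qed.

Lemma geometric_sum_le2 (q : K) N k : 0 <= q -> q <= 2^-1 ->
  \sum_(N <= i < N + k) q ^+ i <= 2 * q ^+ N.
Proof.
move=> q0 q2; rewrite -{1}[N]add0n big_addn addKn.
under eq_bigr do rewrite exprD; rewrite -mulr_suml ler_wpM2r ?exprn_ge0 //.
set S := \sum_(0 <= i < k) _.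
have S0 : 0 <= S by apply: sumr_ge0 => i _; rewrite exprn_ge0.
have : S * 2^-1 <= 1.
  apply: (@le_trans _ _ (S * (1 - q))).
    by rewrite ler_wpM2l // lerBrDl [leRHS]splitr !mul1r lerD.
  rewrite mulrC /S big_mkord -opprB mulNr -subrX1 opprB.
  by rewrite gerBl exprn_ge0.
by rewrite ler_pdivrMr ?ltr0n // mul1r.
Qed.

Lemma expands_series (r : K) f : 0 < r ->
  (forall z, `|z| < r ->
    cvgn (series (fun m => tau (fps_coef f m) * z ^+ m : K^o))) ->
  expands (fun z => limn (series (fun m => tau (fps_coef f m) * z ^+ m : K^o))) f.
Proof.
move=> r0 cv N.
pose S (z : K) := limn (series (fun m => tau (fps_coef f m) * z ^+ m : K^o)).
suff: exists2 H, bounded_germ H &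
  near0 (fun z => S z = (fps_trunc N f).[z] + z ^+ N * H z) by [].
have SE z : `|z| < r ->
    series (fun m => tau (fps_coef f m) * z ^+ m : K^o) @ \oo --> (S z : K^o).
  exact: cv.
clearbody S.
pose rho := r / 2; have rho0 : 0 < rho by rewrite divr_gt0.
have rhor : `|rho| < r by rewrite gtr0_norm // ltr_pdivrMr // mulr_natr mulr2n ltrDl.
have [B aB] : exists B : K, forall m, `|tau (fps_coef f m)| * rho ^+ m <= B.
  have [M [Mr HM]] := cvg_seq_bounded
    (cvgP _ (cvg_series_cvg_0 (cv _ rhor))).
  exists (M + 1) => m; rewrite -(gtr0_norm (exprn_gt0 m rho0)) -normrM.
  by apply: (HM (M + 1)) => //; rewrite ltrDl.
have B0 : 0 <= B by rewrite (le_trans _ (aB 0%N)) // mulr_ge0.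
pose H z := (S z - (fps_trunc N f).[z]) / z ^+ N.
exists H; last first.
  near=> z; have z0 : z != 0 by near: z; exact: nbhs_dnbhs_neq.
  by rewrite /H [z ^+ N * _]mulrC divfK ?expf_neq0 // addrC subrK.
exists (2 * B / rho ^+ N); near=> z.
have z0 : z != 0 by near: z; exact: nbhs_dnbhs_neq.
have zrho : `|z| <= rho / 2.
  by near: z; apply: dnbhs0_le; rewrite divr_gt0.
have zr : `|z| < r.
  rewrite (le_lt_trans zrho) // ltr_pdivrMr // -(gtr0_norm rho0).
  by rewrite (lt_le_trans rhor) // mulr_natr mulr2n lerDl ltW.
rewrite /H normrM normfV normrX ler_pdivrMr ?exprn_gt0 ?normr_gt0 //.
pose q := `|z| / rho.
have q0 : 0 <= q by rewrite divr_ge0 // ltW.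
have q2 : q <= 2^-1 by rewrite ler_pdivrMr // mulrC.
rewrite -[X in _ <= X](_ : B * (2 * q ^+ N) = _); last first.
  by rewrite /q expr_div_n; ring.
have truncE : (fps_trunc N f).[z] =
    series (fun m => tau (fps_coef f m) * z ^+ m : K^o) N.
  by rewrite horner_poly /series /= big_mkord.
have partial m : (N <= m)%N ->
  `|series (fun m => tau (fps_coef f m) * z ^+ m : K^o) m - (fps_trunc N f).[z]| <=
    B * (2 * q ^+ N).
  move=> Nm; rewrite truncE /series /= (big_cat_nat (n := N)) //= addrAC subrr add0r.
  rewrite (le_trans (ler_norm_sum _ _ _)) //.
  apply: (@le_trans _ _ (B * \sum_(N <= i < m) q ^+ i)); last first.
    by rewrite ler_wpM2l // -(subnKC Nm) geometric_sum_le2.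
  rewrite mulr_sumr; apply: ler_sum => i _.
  rewrite normrM normrX.
  have -> : `|z| ^+ i = rho ^+ i * q ^+ i.
    by rewrite -exprMn /q mulrC divfK // gt_eqF.
  by rewrite mulrA ler_wpM2r ?exprn_ge0.
apply/ler_addgt0Pr => e e0.
have /cvgrPdist_le/(_ e e0)[m _ mH] := SE z zr.
have /= := mH (maxn m N) (leq_maxl _ _).
set s := series _ _ => se.
rewrite -(subrK s (S z)) -addrA (le_trans (ler_normD _ _)) // [leRHS]addrC.
by rewrite lerD // /s; apply: partial; exact: leq_maxr.
Unshelve. all: by end_near. Qed.

Lemma expands_lead G f : expands G f -> f != 0 ->
  (G z / z ^+ fps_val f : K^o) @[z --> (0 : K^o)^'] --> (tau (fps_reg f) : K^o).
Proof.
move=> Gf f0; have [fv fo] := fps_valP f0.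
set v := fps_val f in fv fo *; have [H [M HM] GE] := Gf v.+1.
have trE z : (fps_trunc v.+1 f).[z] = tau (fps_reg f) * z ^+ v.
  rewrite horner_poly big_ord_recr /= big1 ?add0r // => i _.
  by rewrite fo // rmorph0 mul0r.
apply/cvgrPdist_le => e e0.
have M0 : 0 < `|M| + 1 by rewrite ltr_wpDl.
near=> z.
have z0 : z != 0 by near: z; exact: nbhs_dnbhs_neq.
have -> : G z = (fps_trunc v.+1 f).[z] + z ^+ v.+1 * H z by near: z; exact: GE.
have -> : ((fps_trunc v.+1 f).[z] + z ^+ v.+1 * H z) / z ^+ v =
    tau (fps_reg f) + z * H z.
  by rewrite trE exprSr -mulrA [z ^+ v * _]mulrC -mulrDl mulfK ?expf_neq0.
rewrite opprD addrA subrr add0r normrN normrM.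
have ze : `|z| <= e / (`|M| + 1).
  by near: z; apply: dnbhs0_le; rewrite divr_gt0.
have HzM : `|H z| <= M by near: z; exact: HM.
apply: (@le_trans _ _ (e / (`|M| + 1) * (`|M| + 1))); last first.
  by rewrite divfK ?gt_eqF.
rewrite ler_pM // (le_trans HzM) // -[M]ger0_norm ?normr_id ?lerDl //.
by rewrite (le_trans _ HzM).
Unshelve. all: by end_near. Qed.

End GermExpansion.

Section DoubleRatioLimit.
Variables (F : fieldType) (K : numFieldType) (tau : {rmorphism F -> K}).

Lemma cvg_dnbhs_exp m : (z ^+ m.+1 : K^o) @[z --> (0 : K^o)^'] --> (0 : K^o).
Proof.
have id0 : (z : K^o) @[z --> (0 : K^o)^'] --> (0 : K^o).
  apply/cvgrPdist_le => e e0; near=> z; rewrite sub0r normrN.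
  by near: z; exact: dnbhs0_le.
elim: m => [|m IH]; first exact: id0.
under eq_fun do rewrite exprS.
by have := cvgM id0 IH; rewrite mulr0; apply.
Unshelve. all: by end_near. Qed.

Lemma cvg_dnbhs_unique (G : K -> K) (a b : K) :
  (G z : K^o) @[z --> (0 : K^o)^'] --> (a : K^o) ->
  (G z : K^o) @[z --> (0 : K^o)^'] --> (b : K^o) -> a = b.
Proof. exact: (@cvg_unique K^o (@norm_hausdorff _ _)). Qed.

Lemma cvg_dnbhs_near (G H : K -> K) (a : K) :
  (\forall z \near (0 : K^o)^', G z = H z) ->
  (G z : K^o) @[z --> (0 : K^o)^'] --> (a : K^o) ->
  (H z : K^o) @[z --> (0 : K^o)^'] --> (a : K^o).
Proof. by move=> GH; apply: cvg_trans; apply: near_eq_cvg. Qed.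

Lemma expz_limit (k : int) (c : K) : c != 0 ->
  (z ^ k : K^o) @[z --> (0 : K^o)^'] --> (c : K^o) -> k = 0.
Proof.
move=> c0; case: k => [[//|m]|m] kc.
  by move: c0; rewrite (cvg_dnbhs_unique kc (cvg_dnbhs_exp m)) eqxx.
have := cvgM (FF := dnbhs_filter (0 : K^o)) (cvg_dnbhs_exp m) kc; rewrite mul0r => lim0.
have lim1 : (1 : K^o) @[z --> (0 : K^o)^'] --> (0 : K^o).
  refine (cvg_dnbhs_near (G := fun z => z ^+ m.+1 * z ^ Negz m)
    (H := fun=> 1) _ lim0); near=> z; rewrite /= NegzE -exprnN mulfV //.
  by rewrite expf_neq0 //; near: z; exact: nbhs_dnbhs_neq.
have e : 0 = 1 :> K by apply: (cvg_dnbhs_unique lim1); exact: cvg_cst.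
by move/eqP: e; rewrite eq_sym oner_eq0.
Unshelve. all: by end_near. Qed.

Lemma double_ratio_limit (f00 f01 f11 f10 : fps F) (G00 G01 G11 G10 : K -> K)
    (m : int) (u : K -> K) (u0 : K) :
  f00 != 0 -> f01 != 0 -> f11 != 0 -> f10 != 0 ->
  expands tau G00 f00 -> expands tau G01 f01 ->
  expands tau G11 f11 -> expands tau G10 f10 ->
  (\forall z \near (0 : K^o)^',
     G00 z / G01 z * (G11 z / G10 z) = z ^ m * u z) ->
  (u z : K^o) @[z --> (0 : K^o)^'] --> (u0 : K^o) -> u0 != 0 ->
  u0 = tau (fps_reg f00 / fps_reg f01 * (fps_reg f11 / fps_reg f10)).
Proof.
move=> nz00 nz01 nz11 nz10 e00 e01 e11 e10 GE ulim u0_neq0.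
have r0 f : f != 0 -> tau (fps_reg f) != 0.
  by move=> f0; rewrite fmorph_eq0 fps_reg_neq0.
have FF := dnbhs_filter (0 : K^o).
have l00 := expands_lead e00 nz00.
have l01 := cvgV (FF := FF) (r0 _ nz01) (expands_lead e01 nz01).
have l11 := expands_lead e11 nz11.
have l10 := cvgV (FF := FF) (r0 _ nz10) (expands_lead e10 nz10).
have lim := cvgM (FF := FF) (cvgM (FF := FF) (cvgM (FF := FF) l00 l01)
  (cvgM (FF := FF) l11 l10)) (cvgV (FF := FF) u0_neq0 ulim).
set L := (X in _ --> X) in lim.
pose k : int := m + (fps_val f01 + fps_val f10)%N%:Z
  - (fps_val f00 + fps_val f11)%N%:Z.
have kE : (z ^ k : K^o) @[z --> (0 : K^o)^'] --> (L : K^o).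
  apply: cvg_dnbhs_near lim; near=> z => /=.
  have z0 : z != 0 by near: z; exact: nbhs_dnbhs_neq.
  have uz0 : u z != 0 by near: z; exact: (cvgr_neq0 _ ulim).
  have GEz : G00 z / G01 z * (G11 z / G10 z) = z ^ m * u z by near: z.
  rewrite !(invfM, invrK).
  transitivity (G00 z / G01 z * (G11 z / G10 z) / u z *
     (z ^+ (fps_val f01 + fps_val f10) / z ^+ (fps_val f00 + fps_val f11))).
    rewrite !exprD invfM; set x := (G01 z)^-1; set y := (G10 z)^-1.
    set w := (u z)^-1; set a := (z ^+ fps_val f00)^-1.
    by set b := (z ^+ fps_val f11)^-1; ring.
  by rewrite GEz mulfK // !expfzDr // exprnP exprnN mulrA.
have L0 : L != 0.
  by rewrite /L !mulf_neq0 ?invr_eq0 ?r0.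
have k0 := expz_limit L0 kE; rewrite k0 in kE.
have L1 : L = 1 by apply: (cvg_dnbhs_unique kE); exact: cvg_cst.
apply: (mulIf (x := u0^-1)); first by rewrite invr_eq0.
by rewrite divff // -[LHS]L1 /L !rmorphM !fmorphV.
Unshelve. all: by end_near. Qed.

End DoubleRatioLimit.

(** * Complex limits and the limit period *)

Section ComplexModulus.
Variable R : realType.
Local Notation C := R[i].
Implicit Types z w : C.

Lemma normc_cabs z : `|z| = (cabs z)%:C%C.
Proof. by []. Qed.

Lemma ltr_cabs z (r : R) : (`|z| < r%:C%C) = (cabs z < r).
Proof. by rewrite normc_cabs ltcR. Qed.

Lemma cabsM z w : cabs (z * w) = cabs z * cabs w.
Proof. exact: ComplexField.Normc.normcM. Qed.

Lemma cabs_gt0 z : (0 < cabs z) = (z != 0).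
Proof. by rewrite -(@ltcR R) -normc_cabs normr_gt0. Qed.

Lemma cabs_ratr (q : rat) : cabs (ratr q) = ratr `|q| :> R.
Proof.
have -> : ratr q = (ratr q)%:C%C :> C.
  exact/esym/(fmorph_eq_rat (real_complex R \o ratr)).
by rewrite /cabs /= expr0n addr0 sqrtr_sqr ratr_norm.
Qed.

Lemma sum_ln_cabs (I : Type) (r : seq I) (z : I -> C) :
  (forall i, z i != 0) ->
  \sum_(i <- r) ln (cabs (z i)) = ln (cabs (\prod_(i <- r) z i)).
Proof.
move=> z0; elim: r => [|i r IH].
  by rewrite !big_nil /cabs ComplexField.Normc.normc1 ln1.
rewrite !big_cons IH cabsM lnM // posrE cabs_gt0 //.
by rewrite prodf_seq_neq0 (eq_all (a2 := predT)) ?all_predT.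
Qed.

End ComplexModulus.

Section Assembly.
Variables (R : realType) (kappa : fieldExtType rat).
Local Notation C := R[i].

Lemma embeddings_sum (F : (kappa -> C) -> R) :
  exists T : 'I_(\dim {:kappa}) -> {rmorphism kappa -> C},
    \sum_(sigma \in @embeddings R kappa) F sigma = \sum_i F (T i) /\
    forall x, \prod_i T i x = ratr (\det (mul_matrix x)).
Proof.
have [T [Tinj Tsurj TE]] := embedding_family kappa C.
exists T; split=> //.
have -> : @embeddings R kappa = [set (T i : kappa -> C) | i in setT].
  apply/seteqP; split=> [_ [tau ->]|_ [i _ <-]]; last by exists (T i).
  by have [i ti] := Tsurj tau; exists i => //; apply/funext => x; rewrite ti.
rewrite fsbig_image; last first.
  by move=> i j _ _ ij; apply: Tinj => x; rewrite ij.
rewrite [RHS](fsbig_seq _ _ (index_enum_uniq _)).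
have -> // : [set: 'I_(\dim {:kappa})] = [set` index_enum _].
by apply/seteqP; split=> i //= _; rewrite mem_index_enum.
Qed.

Lemma limit_periodE (tau : {rmorphism kappa -> C}) k n
    (A B : 'I_2 -> {vspace 'rV[laurent kappa]_n.+1}) v :
  complementary k A B -> is_limit_period tau k A B v ->
  exists a b : 'I_2 -> seq 'rV[fps kappa]_n.+1,
  [/\ forall i, basis_of (A i) (map (@toK _ _) (a i)),
      forall i, basis_of (B i) (map (@toK _ _) (b i)) &
      v = tau (limit_ratio a b)].
Proof.
move=> cAB [r [m [u [a [b [r0 /all_and2[ba bb] cv [du u0 v0] crE]]]]]].
exists a, b; split=> //.
have w0 i j := complementary_wedge_neq0 cAB (ba i) (bb j).
pose ev z (X : seq 'rV[fps kappa]_n.+1) :=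
  [seq map_mx (fps_eval (tau : kappa -> C) ^~ z) w | w <- X].
pose G i j z := wedge (ev z (a i) ++ ev z (b j)).
have sab i j : size (a i ++ b j) = n.+1.
  rewrite -(size_map (@toK _ _)) map_cat.
  by rewrite (basis_size (complementary_basis cAB (ba i) (bb j))) dimvf /dim /= mul1n.
have GE i j : expands tau (G i j) (wedge (a i ++ b j)).
  apply: expands_det => p q; rewrite mxE.
  under [X in expands _ X]eq_fun do rewrite mxE -map_cat (nth_map 0) ?sab // mxE.
  apply: (@expands_series _ _ _ r%:C%C); first by rewrite ltcR.
  move=> z; rewrite ltr_cabs => zr.
  have : (a i ++ b j)`_p \in a i ++ b j by rewrite mem_nth // sab.
  by rewrite mem_cat => /orP[h|h]; [apply: (cv i _ _ _ z zr)|apply: (cv j _ _ _ z zr)];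
    rewrite h ?orbT.
have ulim : (u z : C^o) @[z --> (0 : C^o)^'] --> (v : C^o).
  rewrite -u0; apply/continuous_withinNx.
  apply: differentiable_continuous; apply/derivable1_diffP; apply: du.
  by rewrite /cabs ComplexField.Normc.normc0.
apply: (@double_ratio_limit _ _ tau (wedge (a 0 ++ b 0)) (wedge (a 0 ++ b 1))
  (wedge (a 1 ++ b 1)) (wedge (a 1 ++ b 0)) (G 0 0) (G 0 1) (G 1 1) (G 1 0) m u)
  => //.
near=> z.
have z0 : z != 0 by near: z; exact: nbhs_dnbhs_neq.
have zr : cabs z < r.
  by rewrite -ltr_cabs; near: z; apply: dnbhs0_lt; rewrite ltcR.
have [cz <-] := crE z (introT andP (conj (etrans (cabs_gt0 z) z0) zr)).
have span_basis_of (U : {vspace 'rV[laurent kappa]_n.+1}) X :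
    basis_of U (map (@toK _ _) X) -> \dim (plane_at tau X z) = \dim U ->
    basis_of (plane_at tau X z) (ev z X).
  move=> bX dX; apply: basis_span_free => //.
  by rewrite /free -[span _]/(plane_at tau X z) dX -(basis_size bX) !size_map.
case: (cAB) (cz) => dA dB _ [dAz dBz _].
rewrite (cross_ratio_basis cz (a := fun i => ev z (a i))
  (b := fun j => ev z (b j))) // => i.
  by apply: (span_basis_of _ _ (ba i)); rewrite dA dAz.
by apply: (span_basis_of _ _ (bb i)); rewrite dB dBz.
Unshelve. all: by end_near. Qed.

End Assembly.

Theorem corollaryC (R : realType) (kappa : fieldExtType rat) (k n : nat)
    (A B : 'I_2 -> {vspace 'rV[laurent kappa]_n.+1})
    (u : (kappa -> R[i]) -> R[i]) :
  class_number_one kappa ->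
  complementary k A B ->
  algebraic_family A B ->
  (forall sigma, embeddings sigma -> is_limit_period sigma k A B (u sigma)) ->
  let As i := special_fibre (A i) in
  let Bs j := special_fibre (B j) in
  (forall sigma, embeddings sigma ->
    real_class sigma (ln (cabs (u sigma))) =
    [set x + y | x in log_class sigma (arithmetic_cross_ratio As Bs)
               & y in log_class sigma (clim_over_car A B)]) /\
  \sum_(sigma \in @embeddings R kappa) ln (cabs (u sigma)) =
    ln (ratr (class_norm (arithmetic_cross_ratio As Bs))) +
    ln (ratr (class_norm (clim_over_car A B))).
Proof.
move=> cl cAB _ up As Bs; have pidO := integers_pid cl.
have /choice[a /all_and2[_ ba]] : forall i, exists X,
    lattice_basis (A i) X /\ basis_of (A i) (map (@toK _ _) X).
  by move=> i; have [X ? ?] := lattice_basis_exists (A i); exists X.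
have /choice[b /all_and2[_ bb]] : forall i, exists X,
    lattice_basis (B i) X /\ basis_of (B i) (map (@toK _ _) X).
  by move=> i; have [X ? ?] := lattice_basis_exists (B i); exists X.
set rho := limit_ratio a b.
have rho0 : rho != 0 by exact: (limit_ratio_neq0 cAB ba bb).
have uE (tau : {rmorphism kappa -> R[i]}) : u tau = tau rho.
  have [|a' [b' [ba' bb' ->]]] := limit_periodE cAB (up (tau : kappa -> R[i]) _).
    by exists tau.
  by rewrite (limit_ratio_basis cAB ba' bb' ba bb).
have lnM_tau (tau : {rmorphism kappa -> R[i]}) x y : x * y != 0 ->
    ln (cabs (tau (x * y))) = ln (cabs (tau x)) + ln (cabs (tau y)).
  rewrite mulf_eq0 negb_or => /andP[x0 y0].
  by rewrite rmorphM cabsM lnM // posrE cabs_gt0 fmorph_eq0.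
have rhoe e : integer_units e -> rho * e != 0.
  by case=> e0 _ _; rewrite mulf_neq0.
split=> [_ [tau ->]|].
  rewrite uE; apply/seteqP; split=> [_ [e ue <-]|_ [_ [x Ax <-] [_ [y Cy <-] <-]]].
    have [x [y [Ax Cy xy]]] := arithmetic_limit_product_unit pidO cAB ba bb ue.
    exists (ln (cabs (tau x))); first by exists x.
    exists (ln (cabs (tau y))); first by exists y.
    by rewrite -!lnM_tau ?xy ?rhoe.
  have [e ue xy] := arithmetic_limit_product pidO cAB ba bb Ax Cy.
  by exists e => //; rewrite -!lnM_tau ?xy ?rhoe.
have [T [-> TE]] := embeddings_sum (fun sigma => ln (cabs (u sigma))).
have Ax := xgetPex 1 (arithmetic_cross_ratio_nonempty pidO As Bs).
have Cy := xgetPex 1 (clim_over_car_nonempty pidO cAB).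
rewrite /class_norm; set x := xget 1 _ in Ax *; set y := xget 1 _ in Cy *.
have [e ue xy] := arithmetic_limit_product pidO cAB ba bb Ax Cy.
have := rhoe _ ue; rewrite -xy mulf_eq0 negb_or => /andP[x0 y0].
under eq_bigr do rewrite uE.
rewrite sum_ln_cabs => [|i]; last by rewrite fmorph_eq0.
rewrite TE cabs_ratr -abs_normE -[abs_norm rho]mulr1 -(abs_norm_unit ue).
rewrite -abs_normM -/rho -xy abs_normM rmorphM /= lnM // posrE ltr0q.
  exact: abs_norm_gt0.
exact: abs_norm_gt0.
Qed.
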